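(* Let $n\ge 2$ be an integer. For $X\in \mathsf{M}_n(\mathbb{Z})$ (the set of $n\times n$ integer matrices) let $\|X\|$ denote the maximum of the absolute values of the entries of $X$, and for $T\ge 1$ define $$N(T)=\#\{(X,Y)\in \mathsf{M}_n(\mathbb{Z})^2:\ \|X\|\le T,\ \|Y\|\le T,\ XY=YX\}.$$ Then for all $T\ge 1$, $$N(T)\ll_n T^{\,n^2+2-\frac{2}{n+1}},$$ where the implied constant depends only on $n$. *)

(* Defs.v *)
From HB Require Import structures.
From mathcomp Require Import all_boot all_order all_algebra finmap.
From mathcomp Require Import all_classical all_reals all_analysis.
Set Implicit Arguments.
Unset Strict Implicit.
Unset Printing Implicit Defensive.
Import Order.TTheory GRing.Theory Num.Theory.
Import numFieldNormedType.Exports.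
Local Open Scope classical_set_scope.
Local Open Scope ring_scope.

(* On 'M[int]_n, `|X| is the library's max norm mx_norm, with values in int. *)
Definition commuting_pairs (R : realType) (n : nat) (T : R) :
    set ('M[int]_n * 'M[int]_n) :=
  [set XY | [/\ `|XY.1|%:~R <= T, `|XY.2|%:~R <= T
              & XY.1 *m XY.2 = XY.2 *m XY.1]].

Lemma int_mx_normE (n : nat) (X : 'M[int]_n) :
  `|X| = \big[Num.max/0]_ij `|X ij.1 ij.2|.
Proof. exact: mx_normrE. Qed.

Lemma finite_mx_ball (R : realType) (n : nat) (T : R) :
  finite_set [set X : 'M[int]_n | `|X|%:~R <= T].
Proof.
pose k := `|Num.floor T|%N.
pose f (g : {ffun 'I_n * 'I_n -> 'I_k.*2.+1}) : 'M[int]_n :=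
  \matrix_(i, j) ((g (i, j))%:Z - k%:Z).
apply: (@sub_finite_set _ _ (f @` setT)); last first.
  by apply: finite_image; exact: finite_finset.
move=> X /= XT.
have Xk i j : (`|X i j| <= k)%N.
  have XijX : `|X i j| <= `|X|.
    by rewrite int_mx_normE; apply/bigmax_geP; right => /=; exists (i, j).
  have : `|X i j| <= Num.floor T.
    by rewrite floor_ge_int (le_trans _ XT)// ler_int.
  by rewrite -lez_nat abszE => h; rewrite /k abszE; apply: le_trans h (ler_norm _).
exists [ffun ij => inord `|(X ij.1 ij.2 + k%:Z)%R|%N] => //.
apply/matrixP => i j; rewrite mxE ffunE /=.
have := Xk i j; rewrite -lez_nat abszE ler_norml => /andP[h1 h2].
have h3 : 0 <= X i j + k%:Z by rewrite -lerBlDr sub0r.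
rewrite inordK; first by rewrite gez0_abs// addrK.
by rewrite ltnS -lez_nat gez0_abs// -addnn PoszD lerD2r.
Qed.

Lemma finite_commuting_pairs (R : realType) (n : nat) (T : R) :
  finite_set (@commuting_pairs R n T).
Proof.
have fb := @finite_mx_ball R n T.
by apply: sub_finite_set (finite_setX fb fb) => -[X Y] /= [? ? _].
Qed.

(* fset_set is a junk value on infinite sets; finite_commuting_pairs shows
   that this case does not occur here. *)
Definition Ncomm (R : realType) (n : nat) (T : R) : nat :=
  #|` fset_set (@commuting_pairs R n T)|.

(* Main.v *)
Require Import Defs.
From mathcomp Require Import all_boot all_order all_fingroup all_algebra all_field finmap.
From mathcomp Require Import zify ring lra.
Set Implicit Arguments.
Unset Strict Implicit.
Unset Printing Implicit Defensive.

(* Write t for the integer part of T and let H be maximal with H ^ (n + 1) <= t; choose a prime p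
   comparable to H t (Chebyshev). The matrices commuting with X modulo p form an F_p-space L(X),
   and a Fejer-type argument bounds the number of Y in L(X) of norm <= t by H ^ (- n^2) |L(X)|
   times the number of integer matrices c of norm <= H orthogonal to L(X) for the trace form. So
   it is enough to bound, for each fixed c, the sum of |L(X)| over the X of norm <= t with
   c orthogonal to L(X). Here c is zero, or it has trace zero and is not scalar, since I is in L(X).

   Every X commutes with some cyclic R (over an algebraic closure, and then with many R having
   prescribed coordinates in [-t, t]), so |L(X)| can be traded for a count of pairs (X, R). If r is
   the largest nullity of X - x, then dim L(X) <= n r, and X is x plus a product of r factors
   R - y_i, with y_i eigenvalues of R, times a polynomial of degree < n - r in R; moreover
   tr(c R^k) = 0 for all k. By Fillmore's theorem c may be assumed to have diagonal
   (1, ..., 1, 1 - n); the leading forms in the diagonal entries of R of the equations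
   tr(c R^k) = 0 are then power sums, which by Newton's identities makes n - 1 diagonal entries of
   R integral over the other parameters. The y_i are integral as well. A set of points with
   coordinates in a set of size s is not larger than the space of polynomial functions of degree
   O(s) on it, and reducing the powers of the integral variables shows that there are
   O(t ^ (n^2 + 2 - r)) pairs if c is not zero and O(t ^ (n^2 + n + 1 - r)) pairs if c = 0. *)

(** * Primes in intervals *)

Section Bertrand.

Definition primorial N := \prod_(0 <= p < N.+1 | prime p) p.
Local Notation central N := 'C(N.*2, N).

Lemma central_gt0 N : 0 < central N.
Proof. by rewrite bin_gt0 -addnn leq_addr. Qed.

Lemma central_le N : central N <= 4 ^ N.
Proof.
rewrite (_ : 4 ^ N = 2 ^ N.*2); last by rewrite -muln2 mulnC expnM.
rewrite -[2]/(1 + 1) expnDn (bigD1 (inord N)) //=.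
by rewrite inordK ?exp1n ?muln1 ?leq_addr // ltnS -addnn leq_addr.
Qed.

Lemma central_ge N : 2 ^ N <= central N.
Proof.
elim: N => // N IH; rewrite doubleS expnS mul2n -addnn binS.
apply: leq_add; apply: leq_trans IH _; first by rewrite binS leq_addl.
by case: N => // N; rewrite doubleS binS leq_addr.
Qed.

Lemma prime_dvd_fact p N : prime p -> p %| N`! -> p <= N.
Proof.
move=> pp; elim: N => [|N IH]; first by rewrite dvdn1 => /eqP p1; rewrite p1 in pp.
rewrite factS Euclid_dvdM // => /orP[/dvdn_leq -> //|/IH pN]; exact: leq_trans pN _.
Qed.

Lemma prime_dvd_central p N : prime p -> N < p <= N.*2 -> p %| central N.
Proof.
move=> pp /andP[Np p2N].
have := bin_fact (leq_addr N N : N <= N + N); rewrite addnK addnn => h.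
have : p %| 'C(N.*2, N) * (N`! * N`!) by rewrite h dvdn_fact // prime_gt0.
by rewrite !Euclid_dvdM // => /orP[//|/orP[] /(prime_dvd_fact pp)]; rewrite leqNgt Np.
Qed.

Lemma prime_le_central p N : prime p -> p %| central N -> p <= N.*2.
Proof.
move=> pp pc; apply: (prime_dvd_fact pp).
by have := bin_fact (leq_addr N N : N <= N + N); rewrite addnK addnn => <-; rewrite dvdn_mulr.
Qed.

(** Indexing the factorization by all primes up to M, with exponent 0 for those that do not divide,
    lets the product be cut at any threshold. *)
Lemma central_prod N M : N.*2 <= M ->
  central N = \prod_(0 <= p < M.+1 | prime p) p ^ logn p (central N).
Proof.
move=> NM; set c := central N; have c0 : 0 < c by exact: central_gt0.
rewrite {1}(prod_prime_decomp c0) prime_decompE big_map /=.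
rewrite [RHS](bigID (mem (primes c))) /= [X in _ = _ * X]big1 ?muln1; last first.
  move=> p /andP[pp pc]; rewrite (_ : logn p c = 0) //; apply/eqP.
  by rewrite -leqn0 leqNgt logn_gt0.
rewrite -[RHS]big_filter; apply: perm_big; apply: uniq_perm.
- exact: primes_uniq.
- by rewrite filter_uniq // iota_uniq.
move=> p; rewrite mem_filter mem_index_iota /= ltnS.
case: (boolP (p \in primes c)) => [|_]; last by rewrite andbF.
rewrite mem_primes => /and3P[pp _ pc]; rewrite pp /=.
by rewrite (leq_trans (prime_le_central pp pc)).
Qed.

(** By Legendre's formula the exponent is the sum over k of floor(2N / p^k) - 2 floor(N / p^k). Each
    term is at most 1 and vanishes once p^k > 2N. *)
Lemma logn_central p N : 0 < N -> prime p -> p ^ logn p (central N) <= N.*2.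
Proof.
move=> N0 pp; have p1 := prime_gt1 pp.
apply: (@leq_trans (p ^ trunc_log p N.*2)); last by rewrite trunc_logP // double_gt0.
rewrite leq_exp2l //.
have := bin_fact (leq_addr N N : N <= N + N); rewrite addnK addnn => h.
have : logn p (central N * (N`! * N`!)) = logn p (N.*2)`! by rewrite h.
rewrite !lognM ?central_gt0 ?muln_gt0 ?fact_gt0 // !logn_fact // => e.
(* Legendre sums of different lengths become comparable: beyond the first power of p exceeding a,
   all terms are zero. *)
have cut a T M : a < p ^ T.+1 ->
    \sum_(1 <= k < M.+1) a %/ p ^ k <= \sum_(1 <= k < T.+1) a %/ p ^ k.
  move=> aT; have [MT|TM] := leqP M T.
    by rewrite [X in _ <= X](@big_cat_nat _ _ _ M.+1) //= leq_addr.
  rewrite (@big_cat_nat _ _ _ T.+1) //=; last exact: ltnW.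
  rewrite [X in _ + X]big_nat [X in _ + X]big1 ?addn0 // => k /andP[Tk _].
  by rewrite divn_small // (leq_trans aT) // leq_exp2l.
have N_lt : N < p ^ N.+1 by apply: ltn_trans (ltn_expl _ p1) _; rewrite ltn_exp2l.
rewrite -(leq_add2r (\sum_(1 <= k < N.+1) N %/ p ^ k + \sum_(1 <= k < N.+1) N %/ p ^ k)) e.
set t := trunc_log p N.*2.
apply: leq_trans (cut _ t _ (trunc_log_ltn _ p1)) _.
apply: (@leq_trans (\sum_(1 <= k < t.+1) (1 + (N %/ p ^ k + N %/ p ^ k)))).
  apply: leq_sum => k _; have pk0 : 0 < p ^ k by rewrite expn_gt0 prime_gt0.
  rewrite -addnn -ltnS -[X in _ < X]addn1 ltn_divLR //.
  have := ltn_ceil N pk0; set x := N %/ p ^ k; move: (p ^ k) => y.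
  nia.
rewrite big_split /= big_split /= sum_nat_const_nat muln1 subn1 leq_add2l.
by rewrite leq_add // cut.
Qed.

(** The primes in (N, 2N] all occur in the central binomial coefficient, which is at most 4^N. *)
Lemma primorial_step N : primorial N.*2 <= primorial N * 4 ^ N.
Proof.
rewrite /primorial (@big_cat_nat _ _ _ N.+1) //=; last by rewrite ltnS -addnn leq_addr.
rewrite leq_mul2l; apply/orP; right; apply: leq_trans (central_le N).
rewrite [X in _ <= X](central_prod (leqnn _)).
rewrite [X in _ <= X](@big_cat_nat _ _ _ N.+1) //=; last by rewrite ltnS -addnn leq_addr.
rewrite -[X in X <= _]mul1n leq_mul //.
  by apply: prodn_gt0.
rewrite big_nat_cond [X in _ <= X]big_nat_cond; apply: leq_prod => p /andP[Np pp].
apply: dvdn_leq; rewrite ?pfactor_gt0 // dvdn_exp // logn_gt0.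
by rewrite mem_primes pp central_gt0 prime_dvd_central.
Qed.

(** Doubling gives 4^N when N is a power of 2. Rounding N up to a power of 2, at most 2N, squares
    the base. *)
Lemma primorial_le N : 0 < N -> primorial N <= 16 ^ N.
Proof.
have mono a b : a <= b -> primorial a <= primorial b.
  move=> ab; rewrite /primorial [X in _ <= X](@big_cat_nat _ _ _ a.+1) //=.
  rewrite -[X in X <= _]muln1 leq_mul2l; apply/orP; right.
  by apply: prodn_cond_gt0 => p; exact: prime_gt0.
have pow2 k : primorial (2 ^ k) <= 4 ^ (2 ^ k).
  elim: k => [|k IH]; first by rewrite /primorial unlock.
  rewrite expnS mul2n; apply: leq_trans (primorial_step _) _.
  by rewrite -addnn expnD leq_mul2r IH orbT.
move=> N0; pose k := trunc_log 2 N.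
have /andP[k1 k2] := trunc_log_bounds (isT : 1 < 2) N0.
apply: leq_trans (mono _ _ (ltnW k2)) (leq_trans (pow2 _) _).
by rewrite -[16]/(4 ^ 2) -expnM leq_exp2l // expnS leq_mul2l.
Qed.

(** This decides the comparison of (2u)^(4u) with 2^(u^2) in [prime_between]; it fails at u = 21,
    whence the threshold. *)
Lemma exp_bound u : 22 <= u -> u.*2 ^ 4 < 2 ^ u.
Proof.
elim: u => // u IH; rewrite leq_eqVlt => /orP[/eqP <-|].
  by apply/ltP/PeanoNat.Nat.ltb_lt; vm_compute.
rewrite ltnS => u22; have := IH u22; rewrite (expnS 2 u).
have : u.+1.*2 ^ 4 <= 2 * u.*2 ^ 4.
  rewrite -!mul2n !expnMn mulnCA leq_mul2l /= !expnS !expn0 !muln1.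
  by move: u22; clear; nia.
by move=> h1 h2; apply: leq_ltn_trans h1 _; rewrite ltn_mul2l.
Qed.

(* Otherwise every prime factor of the central binomial coefficient of 2u^2 is at most N: those
   at most 2u contribute at most (2u)^2 each, and the others occur only once. *)
Lemma prime_between u N : 22 <= u -> 0 < N -> 4 * N <= u ^ 2 ->
  exists2 p, prime p & N < p <= 4 * u ^ 2.
Proof.
move=> u22 N0 Nu; set k := 2 * u ^ 2.
have u0 : 0 < u by apply: leq_trans u22.
have k0 : 0 < k by rewrite muln_gt0 expn_gt0 u0.
have k2 : k.*2 = u.*2 ^ 2 by rewrite /k -!mul2n expnMn mulnA.
case: (boolP (has (fun p => prime p && (N < p)) (iota 0 k.*2.+1))).
  case/hasP => p; rewrite mem_iota add0n ltnS => /= pk /andP[pp Np]; exists p => //.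
  by rewrite Np (leq_trans pk) // k2 -mul2n expnMn.
move/hasPn => noprime; exfalso.
have noP p : prime p -> p <= k.*2 -> p <= N.
  move=> pp pk; have := noprime p; rewrite mem_iota add0n ltnS pk pp /= -leqNgt.
  exact.
have central_up : central k <= (u.*2 ^ 2) ^ u.*2 * 16 ^ N.
  have uk : u.*2 <= k.*2 by rewrite k2 -{1}[u.*2]expn1 leq_pexp2l // double_gt0.
  rewrite (central_prod (leqnn _)) (@big_cat_nat _ _ _ u.*2.+1) //=.
  apply: leq_mul.
    rewrite big_ltn_cond // /= (_ : (u.*2 ^ 2) ^ u.*2 = \prod_(1 <= i < u.*2.+1) u.*2 ^ 2); last first.
      by rewrite prod_nat_const_nat subn1.
    rewrite big_mkcond; apply: leq_prod => p _; case: ifP => pp.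
      by rewrite -k2 logn_central.
    by rewrite expn_gt0 double_gt0 u0.
  apply: leq_trans (primorial_le N0).
  have [uN|Nu2] := leqP u.*2 N; last first.
    rewrite big_nat_cond big_pred0; first by apply: prodn_cond_gt0 => p; exact: prime_gt0.
    move=> p; apply/negP => /andP[/andP[h1 h2] pp].
    by have := noP p pp h2; rewrite leqNgt (ltn_trans Nu2).
  have NM : N.+1 <= k.*2.+1 by rewrite ltnS; move: Nu; rewrite /k; lia.
  rewrite (@big_cat_nat _ _ _ N.+1) //=.
  rewrite [X in _ * X]big_nat_cond [X in _ * X]big_pred0 ?muln1; last first.
    move=> p; apply/negP => /andP[/andP[h1 h2] pp].
    by have := noP p pp h2; rewrite leqNgt h1.
  rewrite /primorial [X in _ <= X](@big_cat_nat _ _ _ u.*2.+1) //=.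
  rewrite -[X in X <= _]mul1n leq_mul //; first by apply: prodn_cond_gt0 => p; exact: prime_gt0.
  rewrite big_nat_cond [X in _ <= X]big_nat_cond; apply: leq_prod => p /andP[/andP[up pN] pp].
  have p0 := prime_gt0 pp.
  rewrite -[X in _ <= X]expn1 leq_pexp2l // leqNgt; apply/negP => l2.
  have : p ^ 2 <= k.*2 by apply: leq_trans (logn_central k0 pp); rewrite leq_pexp2l.
  by rewrite k2 leq_exp2r // leqNgt up.
have := leq_trans (central_ge k) central_up.
rewrite leqNgt => /negP; apply.
(* Here k = 2u^2. The factor (2^u)^u beats the contribution of the small primes, and 2^(u^2) absorbs
   16^N because 4N <= u^2. *)
have -> : 2 ^ k = (2 ^ u) ^ u * 2 ^ (u ^ 2) by rewrite -expnM -expnD /k mul2n -addnn mulnn.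
have -> : (u.*2 ^ 2) ^ u.*2 = (u.*2 ^ 4) ^ u by rewrite -!expnM -!muln2; congr (_ ^ _); lia.
have h : 16 ^ N <= 2 ^ (u ^ 2) by rewrite -[16]/(2 ^ 4) -expnM leq_exp2l.
apply: (@leq_ltn_trans ((u.*2 ^ 4) ^ u * 2 ^ (u ^ 2))); first by rewrite leq_mul2l h orbT.
by rewrite ltn_mul2r expn_gt0 /= ltn_exp2r // exp_bound.
Qed.

Lemma weak_bertrand : exists2 c, 0 < c & forall N, 0 < N -> exists2 p, prime p & N < p <= c * N.
Proof.
have [q q121 pq] := prime_above 121.
(* The prime q serves all N <= 121. For larger N the least u with 4N <= u^2 is at least 22, and u <=
   2(u - 1) with (u - 1)^2 < 4N gives 4u^2 <= 64N. *)
exists (maxn 64 q) => [|N N0]; first by rewrite leq_max.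
have [N121|N121] := leqP N 121.
  exists q => //; rewrite (leq_ltn_trans N121) //=.
  by rewrite -[X in X <= _]muln1 leq_mul // leq_maxr.
have exu : exists u, 4 * N <= u ^ 2.
  exists (4 * N); nia.
case: (ex_minnP exu) => u Nu umin.
have u22 : 22 <= u.
  rewrite leqNgt; apply/negP => u22; nia.
have [p pp /andP[Np pu]] := prime_between u22 N0 Nu.
exists p => //; rewrite Np (leq_trans pu) //.
have : u.-1 ^ 2 < 4 * N.
  by rewrite ltnNge; apply/negP => /umin; rewrite leqNgt prednK ?leqnn //; lia.
move=> hu; apply: (@leq_trans (64 * N)); last by rewrite leq_mul2r leq_maxl orbT.
have h : u <= 2 * u.-1 by lia.
have := leq_mul h h; rewrite !mulnn expnMn; move: hu; rewrite -!mulnn; lia.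
Qed.

End Bertrand.

Import Order.TTheory GRing.Theory Num.Theory.
Local Open Scope ring_scope.

(** * Polynomial functions of bounded weighted degree *)

Section Span.
Variables (K : fieldType) (V : finType) (G : Type) (v : V -> G -> K).
Implicit Types (m : {ffun V -> nat}) (P Q : pred {ffun V -> nat}) (f : G -> K).

Definition monom m (g : G) := \prod_i v i g ^+ m i.

(** The [v i] are functions on G, not independent variables: it is the relations between them that
    allow monomials to be eliminated. *)
Definition spanned P f :=
  exists s : seq (K * {ffun V -> nat}),
    all (fun t => P t.2) s /\ forall g, f g = \sum_(t <- s) t.1 * monom t.2 g.

Lemma eq_spanned P f f' : f =1 f' -> spanned P f -> spanned P f'.
Proof. by move=> ff [s [Ps fs]]; exists s; split=> // g; rewrite -ff. Qed.

Lemma sub_spanned P Q f : (forall m, P m -> Q m) -> spanned P f -> spanned Q f.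
Proof. by move=> PQ [s [Ps fs]]; exists s; split=> //; apply: sub_all Ps => t; exact: PQ. Qed.

Lemma spanned0 P : spanned P (fun=> 0).
Proof. by exists [::]; split=> // g; rewrite big_nil. Qed.

Lemma spanned_monom P m : P m -> spanned P (monom m).
Proof.
by move=> Pm; exists [:: (1, m)]; rewrite /= Pm; split=> // g; rewrite big_seq1 mul1r.
Qed.

Lemma spannedD P f f' : spanned P f -> spanned P f' -> spanned P (fun g => f g + f' g).
Proof.
move=> [s [Ps fs]] [s' [Ps' fs']]; exists (s ++ s'); rewrite all_cat Ps Ps'.
by split=> // g; rewrite big_cat /= fs fs'.
Qed.

Lemma spannedZ P c f : spanned P f -> spanned P (fun g => c * f g).
Proof.
move=> [s [Ps fs]]; exists [seq (c * t.1, t.2) | t <- s]; split.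
  by rewrite all_map; apply: sub_all Ps.
by move=> g; rewrite big_map fs mulr_sumr; apply: eq_bigr => t _; rewrite mulrA.
Qed.

Lemma spannedN P f : spanned P f -> spanned P (fun g => - f g).
Proof. by move/(spannedZ (-1)); apply: eq_spanned => g; rewrite mulN1r. Qed.

Lemma spannedB P f f' : spanned P f -> spanned P f' -> spanned P (fun g => f g - f' g).
Proof. by move=> Pf /spannedN; exact: spannedD. Qed.

Lemma spanned_sum P (I : Type) (r : seq I) (R : pred I) (F : I -> G -> K) :
  (forall i, R i -> spanned P (F i)) ->
  spanned P (fun g => \sum_(i <- r | R i) F i g).
Proof.
move=> PF; elim: r => [|i r IH].
  by apply: eq_spanned (spanned0 P) => g; rewrite big_nil.
case Ri: (R i).
  by apply: eq_spanned (spannedD (PF i Ri) IH) => g; rewrite big_cons Ri.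
by apply: eq_spanned IH => g; rewrite big_cons Ri.
Qed.

Definition addm m m' := [ffun i => (m i + m' i)%N].

Lemma monomD m m' g : monom (addm m m') g = monom m g * monom m' g.
Proof. by rewrite -big_split; apply: eq_bigr => i _; rewrite ffunE exprD. Qed.

Lemma spannedM P Q (S : pred {ffun V -> nat}) f f' :
  (forall m m', P m -> Q m' -> S (addm m m')) ->
  spanned P f -> spanned Q f' -> spanned S (fun g => f g * f' g).
Proof.
move=> PQ [s [Ps fs]] [s' [Ps' fs']].
exists [seq (t.1 * t'.1, addm t.2 t'.2) | t <- s, t' <- s']; split.
  apply/allP => u /allpairsP [[t t'] /= [ts ts' ->]] /=.
  by apply: PQ; [exact: (allP Ps _ ts)|exact: (allP Ps' _ ts')].
move=> g; rewrite big_allpairs_dep /= fs fs' mulr_suml; apply: eq_bigr => t _.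
by rewrite mulr_sumr; apply: eq_bigr => t' _; rewrite monomD mulrACA.
Qed.

Variable w : V -> nat.

Definition deg m := (\sum_i m i)%N.
Definition wt m := (\sum_i w i * m i)%N.

Lemma degD m m' : deg (addm m m') = (deg m + deg m')%N.
Proof. by rewrite -big_split; apply: eq_bigr => i _; rewrite ffunE. Qed.

Lemma wtD m m' : wt (addm m m') = (wt m + wt m')%N.
Proof. by rewrite -big_split; apply: eq_bigr => i _; rewrite ffunE mulnDr. Qed.

(** The degree D controls the number of monomials in the final count; the weight a measures progress
    when integral variables are eliminated. *)
Definition bounded a D m := (deg m <= D)%N && (wt m <= a)%N.
Definition wspan a D := spanned (bounded a D).

Lemma wspan_le a a' D D' f : (a <= a')%N -> (D <= D')%N -> wspan a D f -> wspan a' D' f.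
Proof.
move=> aa DD; apply: sub_spanned => m /andP[h1 h2].
by rewrite /bounded (leq_trans h1 DD) (leq_trans h2 aa).
Qed.

Lemma wspanM a a' D D' f f' : wspan a D f -> wspan a' D' f' ->
  wspan (a + a') (D + D') (fun g => f g * f' g).
Proof.
apply: spannedM => m m' /andP[h1 h2] /andP[h3 h4].
by rewrite /bounded degD wtD !leq_add.
Qed.

Lemma wspan_const a D c : wspan a D (fun=> c).
Proof.
have h : spanned (bounded a D) (monom [ffun=> 0%N]).
  apply: spanned_monom; rewrite /bounded /deg /wt !big1 // => i _; rewrite ffunE //.
  by rewrite muln0.
apply: eq_spanned (spannedZ c h) => g.
by rewrite /monom big1 ?mulr1 // => i _; rewrite ffunE.
Qed.

Lemma wspan_var i : wspan (w i) 1 (v i).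
Proof.
pose m : {ffun V -> nat} := [ffun j => (j == i) : nat].
have h : spanned (bounded (w i) 1) (monom m).
  apply: spanned_monom; rewrite /bounded /deg /wt (bigD1 i) //= big1; last first.
    by move=> j /negPf ji; rewrite ffunE ji.
  rewrite (bigD1 i) //= big1 ?ffunE ?eqxx ?muln1 ?addn0 ?leqnn // => j /negPf ji.
  by rewrite ffunE ji muln0.
apply: eq_spanned h => g; rewrite /monom (bigD1 i) //= ffunE eqxx big1 ?mulr1 //.
by move=> j /negPf ji; rewrite ffunE ji.
Qed.

Lemma wspan_prod (I : Type) (r : seq I) (R : pred I) (a d : I -> nat) (F : I -> G -> K) :
  (forall i, R i -> wspan (a i) (d i) (F i)) ->
  wspan (\sum_(i <- r | R i) a i) (\sum_(i <- r | R i) d i)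
     (fun g => \prod_(i <- r | R i) F i g).
Proof.
move=> PF; elim: r => [|i r IH].
  by apply: eq_spanned (wspan_const _ _ 1) => g; rewrite big_nil.
rewrite !big_cons; case Ri: (R i).
  by apply: eq_spanned (wspanM (PF i Ri) IH) => g; rewrite big_cons Ri.
by apply: eq_spanned IH => g; rewrite big_cons Ri.
Qed.

Lemma wspan_exp a D f k : wspan a D f -> wspan (k * a) (k * D) (fun g => f g ^+ k).
Proof.
move=> h; elim: k => [|k IH].
  by apply: eq_spanned (wspan_const _ _ 1) => g; rewrite expr0.
by rewrite !mulSn; apply: eq_spanned (wspanM h IH) => g; rewrite exprS.
Qed.

Lemma wspan_mulmx p q r a b c d (A : G -> 'M[K]_(p, q)) (B : G -> 'M[K]_(q, r)) :
  (forall i j, wspan a b (fun g => A g i j)) -> (forall i j, wspan c d (fun g => B g i j)) ->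
  forall i j, wspan (a + c) (b + d) (fun g => (A g *m B g) i j).
Proof.
move=> hA hB i j.
apply: (@eq_spanned _ (fun g => \sum_k A g i k * B g k j)) => [g|]; first by rewrite mxE.
by apply: spanned_sum => k _; exact: wspanM.
Qed.

Lemma wspan_expmx p a b (A : G -> 'M[K]_p) : (forall i j, wspan a b (fun g => A g i j)) ->
  forall k i j, wspan (k * a) (k * b) (fun g => (A g ^+ k) i j).
Proof.
move=> hA; elim=> [|k IH] i j.
  by apply: eq_spanned (wspan_const _ _ (i == j)%:R) => g; rewrite expr0 mxE.
by rewrite !mulSn; apply: eq_spanned (wspan_mulmx hA IH i j) => g; rewrite exprS.
Qed.

Lemma wspan_det p a b (A : G -> 'M[K]_p) : (forall i j, wspan a b (fun g => A g i j)) ->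
  wspan (p * a) (p * b) (fun g => \det (A g)).
Proof.
move=> hA; apply: spanned_sum => s _; apply: spannedZ.
have := @wspan_prod _ (index_enum 'I_p) xpredT (fun=> a) (fun=> b) (fun i g => A g i ((s : {perm _}) i)).
by rewrite !big_const_ord !iter_addn_0 mulnC (mulnC b); apply.
Qed.

(** As long as some z in Z has exponent at least e, the factor z^e is rewritten by the relation. The
    degree does not grow and the weight drops, so the induction is on the weight. *)
Lemma spanned_reduce (Z : pred V) e :
  (forall z, Z z ->
     spanned (fun m => (deg m <= e)%N && (wt m < e * w z)%N) (fun g => v z g ^+ e)) ->
  forall D f, spanned (fun m => deg m <= D)%N f ->
    spanned (fun m => (deg m <= D)%N && [forall z, Z z ==> (m z < e)%N]) f.
Proof.
move=> rel D f [s [Ps fs]].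
suff H a : forall m, (wt m < a)%N -> (deg m <= D)%N ->
    spanned (fun m => (deg m <= D)%N && [forall z, Z z ==> (m z < e)%N]) (monom m).
  have : spanned (fun m => (deg m <= D)%N && [forall z, Z z ==> (m z < e)%N])
      (fun g => \sum_(t <- s | t \in s) t.1 * monom t.2 g).
    apply: spanned_sum => t ts; apply: spannedZ; apply: (H (wt t.2).+1) => //.
    exact: (allP Ps).
  by apply: eq_spanned => g; rewrite fs -big_seq.
elim: a => // a IH m; rewrite ltnS => ma mD.
case: (boolP [forall z, Z z ==> (m z < e)%N]) => [mr|].
  by apply: spanned_monom; rewrite mD.
rewrite negb_forall => /existsP[z]; rewrite negb_imply -leqNgt => /andP[Zz ez].
pose m' : {ffun V -> nat} := [ffun i => if i == z then (m z - e)%N else m i].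
pose mz : {ffun V -> nat} := [ffun i => if i == z then e else 0%N].
have mE : m = addm mz m'.
  apply/ffunP => i; rewrite !ffunE; case: eqP => [->|] //.
  by rewrite subnKC.
have mzE g : monom mz g = v z g ^+ e.
  rewrite /monom (bigD1 z) //= ffunE eqxx big1 ?mulr1 // => i /negPf iz.
  by rewrite ffunE iz.
have degz : deg mz = e.
  rewrite /deg (bigD1 z) //= ffunE eqxx big1 ?addn0 // => i /negPf iz.
  by rewrite ffunE iz.
have wtz : wt mz = (e * w z)%N.
  rewrite /wt (bigD1 z) //= ffunE eqxx big1 ?addn0 ?(mulnC e) // => i /negPf iz.
  by rewrite ffunE iz muln0.
have : spanned (fun m => (deg m <= D)%N && (wt m < a)%N)
    (fun g => v z g ^+ e * monom m' g).
  apply: (@spannedM _ (pred1 m') _ _ _ _ (rel z Zz)) => [u u' /andP[h1 h2] /eqP ->|].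
    move: mD ma; rewrite {1}mE degD degz {1}mE wtD wtz degD wtD => mD ma.
    rewrite (leq_trans _ mD) ?leq_add2r //= (leq_trans _ ma) // ltn_add2r //.
  by apply: spanned_monom; rewrite /= eqxx.
move=> [s' [Ps' fs']].
have : spanned (fun m => (deg m <= D)%N && [forall z, Z z ==> (m z < e)%N])
      (fun g => \sum_(t <- s' | t \in s') t.1 * monom t.2 g).
  by apply: spanned_sum => t /(allP Ps') /andP[? ?]; apply: spannedZ; exact: IH.
by apply: eq_spanned => g; rewrite mE monomD mzE fs' -big_seq.
Qed.

End Span.

(** If all indicator functions of points are combinations of the [phi j], the identity matrix of
    size |G| factors through a space of dimension |J|. *)
Lemma card_le_span (K : fieldType) (G J : finType) (phi : J -> G -> K) :
  (forall g0, exists c : J -> K, forall g, (g == g0)%:R = \sum_j c j * phi j g) ->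
  (#|G| <= #|J|)%N.
Proof.
move=> /fin_all_exists[c hc].
pose C : 'M[K]_(#|G|, #|J|) := \matrix_(i, j) c (enum_val i) (enum_val j).
pose F : 'M[K]_(#|J|, #|G|) := \matrix_(j, i) phi (enum_val j) (enum_val i).
have CF : C *m F = 1%:M.
  apply/matrixP => i k; rewrite !mxE -(inj_eq enum_val_inj) eq_sym hc.
  rewrite (reindex (@enum_val J predT)) /=; last first.
    by apply: onW_bij; exact: enum_val_bij.
  by apply: eq_bigr => j _; rewrite !mxE.
rewrite -[X in (X <= _)%N](mxrank1 K) -CF.
by apply: leq_trans (mxrankM_maxl _ _) _; exact: rank_leq_col.
Qed.

(* All functions on G are polynomials of degree at most D = #|I| * size S * q in v, by
   interpolation, hence combinations of the reduced monomials of degree D. *)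
Lemma card_grid_le (K : fieldType) (V : finType) (G : finType) (v : V -> G -> K)
    (w : V -> nat) (Z : pred V) e q (I : finType) (phi : I -> G -> K) (S : seq K) :
  (forall z, Z z -> spanned v (fun m => (deg m <= e)%N && (wt w m < e * w z)%N)
                      (fun g => v z g ^+ e)) ->
  (forall i, spanned v (fun m => deg m <= q)%N (phi i)) ->
  (forall i g, phi i g \in S) ->
  (forall g g', (forall i, phi i g = phi i g') -> g = g') ->
  (#|G| <= e ^ #|Z| * (#|I| * (size S * q)).+1 ^ (#|V| - #|Z|))%N.
Proof.
move=> rel phiq phiS phi_inj.
set D := (#|I| * (size S * q))%N.
(* All exponents live in one ordinal type; [F i] leaves e values for the integral variables and D +
   1 for the others. *)
pose F i : pred 'I_(maxn e D.+1) := [pred k : 'I_(maxn e D.+1) | (k < if Z i then e else D.+1)%N].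
have cardF : #|family F| = (e ^ #|Z| * D.+1 ^ (#|V| - #|Z|))%N.
  rewrite card_family.
  have -> : [seq #|F x| | x in V] = [seq (if Z x then e else D.+1) | x in V].
    rewrite /image_mem; apply: eq_map => i; rewrite /F.
    rewrite -[RHS]card_ord.
    have h : ((if Z i then e else D.+1) <= maxn e D.+1)%N.
      by case: ifP; rewrite ?leq_maxl ?leq_maxr.
    rewrite -(card_image (f := widen_ord h)); last by move=> x y /(congr1 val) /= /val_inj.
    apply: eq_card => k; rewrite !inE; apply/idP/imageP => [hk|[x _ ->]] //=.
    by exists (Ordinal hk) => //; apply: val_inj.
  rewrite foldrE big_map big_enum /= (bigID Z) /=.
  rewrite (eq_bigr (fun=> e)) => [|i ->] //.
  rewrite [X in (_ * X)%N](eq_bigr (fun=> D.+1)) => [|i /negPf ->] //.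
  rewrite !prod_nat_const; congr (_ ^ _ * _ ^ _)%N.
  by rewrite -(cardC Z) addKn; apply: eq_card => i; rewrite !inE.
rewrite -cardF -[X in (_ <= X)%N]card_sig.
pose toN (j : {x | x \in family F}) : {ffun V -> nat} := [ffun i => val (val j i)].
apply: (@card_le_span K _ _ (fun j => monom v (toN j))) => g0.
have : spanned v (fun m => deg m <= D)%N (fun g => (g == g0)%:R).
  (* A product of Lagrange factors over all coordinates: it is 1 at g0, and at any other point some
     coordinate differs and kills it. *)
  pose d g := \prod_i \prod_(s <- S | s != phi i g0) ((phi i g - s) / (phi i g0 - s)).
  apply: (@eq_spanned _ _ _ _ _ d).
    move=> g; rewrite /d; case: eqP => [->|gg0].
      rewrite big1 // => i _; rewrite big1 // => s hs.
      by rewrite divff // subr_eq0 eq_sym.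
    have [i hi] : exists i, phi i g != phi i g0.
      apply/existsP; apply: contraT; rewrite negb_exists => /forallP h.
      by case: gg0; apply: phi_inj => i; apply/eqP; have := h i; rewrite negbK.
    apply/eqP; rewrite prodf_seq_eq0; apply/hasP; exists i; rewrite ?mem_index_enum //=.
    rewrite prodf_seq_eq0; apply/hasP; exists (phi i g); rewrite ?phiS //= hi.
    by rewrite subrr mul0r eqxx.
  apply: (@sub_spanned _ _ _ _ (bounded (fun=> 0%N) 0 D)).
    by move=> m /andP[].
  have phiq' i : wspan v (fun=> 0%N) 0 q (phi i).
    by apply: sub_spanned (phiq i) => m h; rewrite /bounded h /wt big1.
  have h1 i : wspan v (fun=> 0%N) 0 (size S * q)
      (fun g => \prod_(s <- S | s != phi i g0) ((phi i g - s) / (phi i g0 - s))).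
    have h s : wspan v (fun=> 0%N) 0 q (fun g => (phi i g - s) / (phi i g0 - s)).
      apply: (@eq_spanned _ _ _ _ _ (fun g => (phi i g0 - s)^-1 * (phi i g - s))).
        by move=> g; rewrite mulrC.
      by apply: spannedZ; apply: spannedB; [exact: phiq'|exact: wspan_const].
    apply: (wspan_le _ _ (wspan_prod S (R := fun s => s != phi i g0) (fun s _ => h s))).
      by rewrite big1_eq.
    by rewrite big_const_seq iter_addn_0 mulnC leq_mul2r count_size orbT.
  apply: (wspan_le _ _ (wspan_prod (index_enum I) (R := xpredT) (fun i _ => h1 i))).
    by rewrite big1_eq.
  by rewrite sum_nat_const.
move=> /(spanned_reduce rel)[s [Ps fs]].
have inj m : (deg m <= D)%N && [forall z, Z z ==> (m z < e)%N] ->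
    exists j, toN j = m.
  move=> /andP[mD /forallP mZ].
  have mi i : (m i < if Z i then e else D.+1)%N.
    case: ifP => Zi; first by have := mZ i; rewrite Zi.
    by rewrite ltnS; apply: leq_trans mD; rewrite /deg (bigD1 i) //= leq_addr.
  have mi' i : (m i < maxn e D.+1)%N.
    by apply: leq_trans (mi i) _; case: ifP; rewrite ?leq_maxl ?leq_maxr.
  pose x : {ffun V -> 'I_(maxn e D.+1)} := [ffun i => Ordinal (mi' i)].
  have xE i : x i = Ordinal (mi' i) by rewrite ffunE.
  have hx : x \in family F.
    by apply/familyP => i; rewrite xE; exact: mi.
  by exists (Sub x hx); apply/ffunP => i; rewrite ffunE /= ffunE.
exists (fun j => \sum_(t <- s | t.2 == toN j) t.1) => g; rewrite fs.
rewrite (eq_bigr (fun j => \sum_(t <- s | t.2 == toN j) t.1 * monom v t.2 g)); last first.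
  by move=> j _; rewrite mulr_suml; apply: eq_bigr => t /eqP ->.
rewrite (exchange_big_dep xpredT) //= big_seq [RHS]big_seq; apply: eq_bigr => t ts.
have [j tj] := inj _ (allP Ps _ ts).
rewrite (bigD1 j) /=; last by rewrite tj.
rewrite big1 ?addr0 // => k /andP[/eqP tk kj].
case/negP: kj; apply/eqP; apply: val_inj; apply/ffunP => i; apply: val_inj.
have := congr1 (fun m : {ffun V -> nat} => m i) tk.
by rewrite -tj !ffunE => ->.
Qed.

(** * Prescribing the diagonal by conjugation *)

Section Fillmore.
Variable K : fieldType.

Definition similar_to n (A B : 'M[K]_n) :=
  exists P Q : 'M[K]_n, P *m Q = 1%:M /\ B = Q *m A *m P.

Lemma similar_trans n (A B C : 'M[K]_n) :
  similar_to A B -> similar_to B C -> similar_to A C.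
Proof.
move=> [P [Q [PQ ->]]] [P' [Q' [PQ' ->]]]; exists (P *m P'), (Q' *m Q); split.
  by rewrite mulmxA -(mulmxA P) PQ' mulmx1.
by rewrite !mulmxA.
Qed.

Lemma similar_trace n (A B : 'M[K]_n) : similar_to A B -> \tr B = \tr A.
Proof. by move=> [P [Q [PQ ->]]]; rewrite -mulmxA mxtrace_mulC -mulmxA PQ mulmx1. Qed.

(** A diagonal nonscalar A has two distinct diagonal entries, and conjugating by an elementary
    matrix puts their difference off the diagonal. *)
Lemma similar_offdiag n (A : 'M[K]_n) : ~~ is_scalar_mx A ->
  exists2 B, similar_to A B & exists i j, i != j /\ B j i != 0.
Proof.
move=> nsA.
have [/existsP[i /existsP[j /andP[ij Aji]]]|] := boolP [exists i, exists j, (i != j) && (A j i != 0)].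
  exists A; last by exists i, j.
  by exists 1%:M, 1%:M; rewrite mulmx1 mul1mx mulmx1.
rewrite negb_exists => /forallP A0.
have {}A0 i j : i != j -> A j i = 0.
  move=> ij; apply/eqP; have := A0 i; rewrite negb_exists => /forallP /(_ j).
  by rewrite negb_and ij /= negbK.
case: n A nsA A0 => [|n] A nsA A0.
  by case/negP: nsA; apply/is_scalar_mxP; exists 0; apply/matrixP => -[].
have [i Ai] : exists i, A i i != A 0 0.
  apply/existsP; apply: contraT; rewrite negb_exists => /forallP h.
  case/negP: nsA; apply/is_scalar_mxP; exists (A 0 0); apply/matrixP => i j.
  rewrite mxE; case: (eqVneq i j) => [<-|ij]; last by rewrite mulr0n A0 1?eq_sym.
  by apply/eqP; have := h i; rewrite negbK.
have i0 : i != 0 by apply: contraNneq Ai => ->.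
have AE j k : A j k = A j j *+ (j == k).
  by case: (eqVneq j k) => [<-|jk]; rewrite // A0 // eq_sym.
have Ad : A *m (delta_mx i 0 : 'M_n.+1) = A i i *: delta_mx i 0.
  apply/matrixP => a b; rewrite !mxE (bigD1 i) //= big1 ?addr0 => [|k ki].
    rewrite !mxE eqxx [A a i]AE; case: (eqVneq a i) => [->|_] //=.
    by rewrite mulr0n mul0r mulr0.
  by rewrite mxE (negPf ki) mulr0.
have dA : (delta_mx i 0 : 'M_n.+1) *m A = A 0 0 *: delta_mx i 0.
  apply/matrixP => a b; rewrite !mxE (bigD1 0) //= big1 ?addr0 => [|k k0].
    rewrite !mxE eqxx andbT [A 0 b]AE (eq_sym 0); case: (eqVneq b 0) => [_|_] /=.
      by rewrite andbT mulrC.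
    by rewrite mulr0 andbF mulr0.
  by rewrite mxE (negPf k0) andbF mul0r.
have dd : (delta_mx i 0 : 'M[K]_n.+1) *m (delta_mx i 0 : 'M_n.+1) = 0 by rewrite mul_delta_mx_0 // eq_sym.
exists ((1%:M - delta_mx i 0) *m A *m (1%:M + (delta_mx i 0 : 'M_n.+1))).
  exists (1%:M + delta_mx i 0), (1%:M - delta_mx i 0); split=> //.
  by rewrite mulmxDl mul1mx mulmxBr mulmx1 dd subr0 subrK.
exists 0, i; split; first by rewrite eq_sym.
rewrite mulmxDr mulmx1 mulmxBl mul1mx dA mulmxBl -scalemxAl dd scaler0 subr0 Ad.
rewrite !mxE !eqxx /= !mulr1 A0 1?eq_sym // sub0r addrC eq_sym subr_eq0.
exact: Ai.
Qed.

Lemma similar_tperm n (A : 'M[K]_n) (i j : 'I_n) :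
  similar_to A (xrow i j (xcol i j A)).
Proof.
exists (tperm_mx i j), (tperm_mx i j); split; last by rewrite xrowE xcolE mulmxA.
by rewrite -perm_mxM tperm2 perm_mx1.
Qed.

(** A permutation puts a nonzero entry below the corner. Shearing by a row s changes the corner by -
    s c and the lower block by c s, where c is the column below the corner, so the corner can be
    given any value. A 1 by 1 lower block is always scalar, hence the condition 0 < n. *)
Lemma similar_ulcorner n (A : 'M[K]_(1 + n.+1)) (b : K) : ~~ is_scalar_mx A ->
  exists2 B : 'M[K]_(1 + n.+1), similar_to A B &
    B 0 0 = b /\ ((0 < n)%N -> ~~ is_scalar_mx (drsubmx B)).
Proof.
move=> /similar_offdiag[B0 AB0 [i [j [ij B0ji]]]].
pose B1 : 'M[K]_(1 + n.+1) := xrow 0 i (xcol 0 i B0).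
have AB1 : similar_to A B1 by apply: similar_trans AB0 (similar_tperm _ _ _).
have [k B1k] : exists k : 'I_n.+1, dlsubmx B1 k 0 != 0.
  pose l := tperm 0 i j.
  have l0 : l != 0.
    rewrite /l -[X in _ != X](tpermR 0 i) (inj_eq perm_inj).
    by rewrite eq_sym.
  exists (odflt 0 (unlift 0 l)).
  have : B1 l 0 != 0 by rewrite /B1 !mxE tpermK tpermL.
  case: (unliftP 0 l) l0 => [k ->|->]; last by rewrite eqxx.
  move=> _ /=; rewrite !mxE.
  rewrite (_ : rshift 1 k = lift 0 k); last by apply: val_inj.
  by rewrite (_ : lshift n.+1 0 = 0) //; apply: val_inj.
set c := dlsubmx B1 in B1k; set D := drsubmx B1; set a := ulsubmx B1; set r := ursubmx B1.
have shear (s : 'rV[K]_n.+1) : similar_to B1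
    (block_mx (a - s *m c) (a *m s - s *m c *m s + r - s *m D) c (D + c *m s)).
  exists (block_mx 1%:M s 0 1%:M), (block_mx 1%:M (- s) 0 1%:M); split.
    by rewrite mulmx_block !mulmx1 !mul1mx !mulmx0 !mul0mx !addr0 !add0r addNr -scalar_mx_block.
  rewrite -[B1]submxK -/a -/r -/c -/D !mulmx_block !mulmx1 !mul1mx !mulmx0 !mul0mx !add0r !addr0.
  rewrite !mulNmx mulmxBl [c *m s + D]addrC; congr (block_mx _ _ _ _).
  by rewrite addrA.
pose t := (a 0 0 - b) / c k 0.
pose s0 : 'rV[K]_n.+1 := t *: delta_mx 0 k.
have s0c (u : 'rV[K]_n.+1) : u *m c = 0 -> (a - (s0 + u) *m c) 0 0 = b.
  move=> uc; rewrite mulmxDl uc addr0 -scalemxAl -rowE.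
  rewrite mxE (_ : (- (t *: row k c)) 0 0 = - (t * c k 0)); last by rewrite 3!mxE.
  by rewrite /t divfK // subKr.
have ok u : u *m c = 0 -> ((0 < n)%N -> ~~ is_scalar_mx (D + c *m (s0 + u))) ->
    exists2 B : 'M[K]_(1 + n.+1), similar_to A B &
    B 0 0 = b /\ ((0 < n)%N -> ~~ is_scalar_mx (drsubmx B)).
  move=> uc ns; eexists; first exact: similar_trans AB1 (shear (s0 + u)).
  rewrite block_mxKdr; split=> //.
  rewrite -(s0c u uc) -[RHS](block_mxEul _
    (a *m (s0 + u) - (s0 + u) *m c *m (s0 + u) + r - (s0 + u) *m D) c (D + c *m (s0 + u))).
  by congr (block_mx _ _ _ _ _ _); apply: val_inj.
have [sc|nsc] := boolP (is_scalar_mx (D + c *m s0)); last first.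
  by apply: (ok 0); rewrite ?mul0mx ?addr0.
have [n0|] := eqVneq n 0%N; last rewrite -lt0n => n0.
  by apply: (ok 0) => [|h]; [rewrite mul0mx|have := h; rewrite {1}n0].
have [l lk] : exists l : 'I_n.+1, l != k.
  exists (if k == 0 then ord_max else 0); case: (eqVneq k 0) => [->|]; last by rewrite eq_sym.
  by rewrite -val_eqE /= -lt0n.
(* This u is orthogonal to c, so it leaves the corner alone, while c u has entry c_k^2 at (k, l) and
   destroys scalarity. *)
pose u : 'rV[K]_n.+1 := c k 0 *: delta_mx 0 l - c l 0 *: delta_mx 0 k.
apply: (ok u) => [|_].
  rewrite mulmxBl -!scalemxAl -!rowE; apply/matrixP => x y; rewrite !mxE (ord1 y).
  by rewrite mulrC subrr.
rewrite mulmxDr addrA; apply/negP => /is_scalar_mxP[y yE].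
case/is_scalar_mxP: sc => x xE; rewrite xE in yE.
have := congr1 (fun M : 'M_n.+1 => M k l) yE.
rewrite /u !mxE eq_sym (negPf lk) big_ord1 !mxE !eqxx (negPf lk) /=.
rewrite !mulr0n add0r mulr0 subr0 mulr1 => /eqP; rewrite mulf_eq0 orbb.
by move: B1k; rewrite !mxE => /negPf ->.
Qed.

(** Fillmore's theorem. Corners are prescribed one at a time, the remaining block being kept
    nonscalar; the trace forces the last entry. *)
Lemma similar_diag n (A : 'M[K]_n) (b : 'I_n -> K) : ~~ is_scalar_mx A ->
  \sum_i b i = \tr A -> exists2 B, similar_to A B & forall i, B i i = b i.
Proof.
elim: n A b => [|n IH] A b nsA trA.
  by case/negP: nsA; apply/is_scalar_mxP; exists 0; apply/matrixP => -[].
case: n A b nsA trA IH => [|n] A b nsA trA IH.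
  case/negP: nsA; apply/is_scalar_mxP; exists (A 0 0).
  by apply/matrixP => i j; rewrite !ord1 mxE eqxx.
have [B AB [B00 nsD]] := similar_ulcorner (b 0) nsA.
have trB : \tr (drsubmx (B : 'M_(1 + n.+1))) = \sum_i b (lift 0 i).
  have : \tr B = \sum_i b i by rewrite (similar_trace AB).
  rewrite /mxtrace big_ord_recl [RHS]big_ord_recl B00 => /addrI <-.
  apply: eq_bigr => i _; rewrite !mxE.
  by congr (B _ _); apply: val_inj.
suff [D' [P [Q [PQ D'E]]] D'd] : exists2 D', similar_to (drsubmx (B : 'M_(1 + n.+1))) D' &
    forall i, D' i i = b (lift 0 i).
  pose C : 'M[K]_n.+2 := block_mx (ulsubmx (B : 'M_(1 + n.+1))) (ursubmx (B : 'M_(1 + n.+1)) *m P)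
     (Q *m dlsubmx (B : 'M_(1 + n.+1))) D' : 'M_(1 + n.+1).
  exists C.
    apply: similar_trans AB _.
    exists (block_mx 1%:M 0 0 P : 'M_(1 + n.+1)), (block_mx 1%:M 0 0 Q : 'M_(1 + n.+1)); split.
      by rewrite mulmx_block !mulmx1 !mulmx0 !mul0mx !addr0 add0r PQ -scalar_mx_block.
    rewrite -[X in _ *m X *m _](@submxK _ 1 n.+1 1 n.+1 B) !mulmx_block.
    by rewrite !mulmx1 !mul1mx !mulmx0 !mul0mx !addr0 !add0r /C D'E.
  move=> i; case: (unliftP 0 i) => [j ->|->].
    rewrite -D'd -(block_mxEdr (ulsubmx (B : 'M_(1 + n.+1))) (ursubmx (B : 'M_(1 + n.+1)) *m P)
     (Q *m dlsubmx (B : 'M_(1 + n.+1))) D' j j).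
    by congr (block_mx _ _ _ _ _ _); apply: val_inj.
  rewrite -B00 -(_ : ulsubmx (B : 'M_(1 + n.+1)) 0 0 = B 0 0).
    rewrite -(block_mxEul (ulsubmx (B : 'M_(1 + n.+1))) (ursubmx (B : 'M_(1 + n.+1)) *m P)
     (Q *m dlsubmx (B : 'M_(1 + n.+1))) D' 0 0).
    by congr (block_mx _ _ _ _ _ _); apply: val_inj.
  by rewrite !mxE; congr (B _ _); apply: val_inj.
have [n0|] := eqVneq n 0%N; last by rewrite -lt0n => n0; exact: IH (nsD n0) (esym trB).
exists (drsubmx (B : 'M_(1 + n.+1))).
  by exists 1%:M, 1%:M; rewrite mulmx1 mul1mx mulmx1.
move: trB; rewrite /mxtrace; move: (drsubmx _); subst n => D.
by rewrite !big_ord1 => h i; rewrite !ord1.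
Qed.
End Fillmore.

(** * Newton's identities *)

Section Newton.
Variable K : fieldType.
Implicit Types (s : seq K).

Lemma deriv_prod_XsubC s :
  (\prod_(x <- s) ('X - x%:P))^`() =
  \sum_(x <- s) (\prod_(y <- s) ('X - y%:P)) %/ ('X - x%:P).
Proof.
elim: s => [|a s IH]; first by rewrite !big_nil derivC.
rewrite !big_cons derivM derivXsubC mul1r IH mulKp ?polyXsubC_eq0 //; congr (_ + _).
rewrite mulr_sumr big_seq [RHS]big_seq; apply: eq_bigr => x xs.
by rewrite divp_mulA // dvdp_XsubCl root_prod_XsubC.
Qed.

(** Synthetic division: the recursion f_(j+1) = g_j - x g_(j+1) is solved downwards from the top
    coefficient. *)
Lemma coef_divXsubC (f : {poly K}) x k : root f x ->
  (f %/ ('X - x%:P))`_k = \sum_(i < size f - k.+1) f`_(k.+1 + i) * x ^+ i.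
Proof.
rewrite -dvdp_XsubCl => /divpK; set g := f %/ _ => fE.
have fk j : f`_j.+1 = g`_j - x * g`_j.+1.
  by rewrite -fE mulrBr coefB coefMX /= coefMC mulrC.
elim: {k}(size f - k.+1)%N {-2}k (erefl (size f - k.+1)%N) => [|d IH] k dE; rewrite dE.
  rewrite big_ord0 nth_default // /g size_divp ?polyXsubC_eq0 // size_XsubC.
  by rewrite leq_subLR add1n -subn_eq0 dE.
have dE' : (size f - k.+2)%N = d by rewrite subnS dE.
have := IH k.+1 dE'; rewrite dE' => gk.
rewrite big_ord_recl addn0 mulr1 fk gk -addrA mulr_sumr -[LHS]addr0; congr (_ + _).
rewrite addrC; apply/esym/eqP; rewrite subr_eq0; apply/eqP; apply: eq_bigr => i _.
by rewrite /= -addSnnS exprS mulrCA.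
Qed.

Definition power_sum s i := \sum_(x <- s) x ^+ i.

(** Compare coefficients in X f' = sum of X f / (X - x), where X f / (X - x) = f + x f / (X - x). *)
Lemma newton s a : (a <= size s)%N ->
  let f := \prod_(x <- s) ('X - x%:P) in
  (size s - a)%:R * f`_a = - \sum_(i < size s - a) f`_(a.+1 + i) * power_sum s i.+1.
Proof.
move=> le_as f.
have sf : size f = (size s).+1 by rewrite size_prod_XsubC.
have : 'X * f^`() = (size s)%:R *: f + \sum_(x <- s) x *: (f %/ ('X - x%:P)).
  rewrite deriv_prod_XsubC mulr_sumr -/f.
  rewrite (_ : _ *: f = \sum_(x <- s) f); last first.
    by rewrite big_const_seq count_predT iter_addr_0 scaler_nat.
  rewrite -big_split big_seq [RHS]big_seq; apply: eq_bigr => x xs /=.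
  set g := f %/ _; have <- : g * ('X - x%:P) = f.
    by rewrite divpK // dvdp_XsubCl root_prod_XsubC.
  by rewrite mulrBr -mul_polyC [x%:P * g]mulrC subrK mulrC.
move=> /(congr1 (fun p : {poly K} => p`_a)).
rewrite coefXM coefD coefZ coef_sum.
rewrite (_ : (if _ then _ else _) = a%:R * f`_a); last first.
  by case: a {le_as} => [|a]; rewrite ?mul0r //= coef_deriv mulr_natl.
rewrite natrB // mulrBl => ->; rewrite opprD addNKr; congr (- _).
rewrite (eq_big_seq (fun x => \sum_(i < size s - a) f`_(a.+1 + i) * x ^+ i.+1)).
  by rewrite exchange_big; apply: eq_bigr => i _; rewrite mulr_sumr.
move=> x xs; rewrite coefZ coef_divXsubC ?root_prod_XsubC // sf subSS mulr_sumr.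
by apply: eq_bigr => i _; rewrite exprS mulrCA.
Qed.

End Newton.

(** * Integrality of the diagonal entries *)

Section Relations.
Variables (K : fieldType) (V : finType) (G : Type) (v : V -> G -> K) (w : V -> nat).
Local Notation wspan := (wspan v w).

(** Up to sign the coefficient is the elementary symmetric function of degree [size r - k]; beyond
    the size of r both it and the truncated difference are 0. *)
Lemma wspan_coef_prod_XsubC (r : seq (G -> K)) :
  (forall i, (i < size r)%N -> wspan 1 1 (nth (fun=> 0) r i)) ->
  forall k, wspan (size r - k) (size r - k)
    (fun g => (\prod_(x <- [seq h g | h <- r]) ('X - x%:P))`_k).
Proof.
elim: r => [|x r IH] rP k.
  by apply: eq_spanned (wspan_const _ _ _ _ (k == 0)%:R) => g; rewrite big_nil coef1.
have {}IH := IH (fun i => rP i.+1); have xP := rP 0%N (ltn0Sn _).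
set F := fun k g => (\prod_(x <- [seq h g | h <- r]) ('X - x%:P))`_k in IH.
have sF g : size (\prod_(x <- [seq h g | h <- r]) ('X - x%:P)) = (size r).+1.
  by rewrite size_prod_XsubC size_map.
apply: (@eq_spanned _ _ _ _ _ (fun g => (if k == 0 then 0 else F k.-1 g) - x g * F k g)).
  by move=> g; rewrite /= big_cons mulrBl coefB coefXM coefCM.
apply: spannedB.
  case: k => [|k] /=; last by rewrite subSS; exact: IH.
  exact: spanned0.
case: (leqP k (size r)) => kr.
  by rewrite /= subSn // -add1n; exact: wspanM.
by apply: eq_spanned (spanned0 _ _) => g; rewrite /F nth_default ?mulr0 // sF.
Qed.

Variables (m : nat) (R : G -> 'M[K]_m.+1).
Hypothesis R_sp : forall i j : 'I_m.+1, wspan ((i == j) && (i < m)%N) 1 (fun g => R g i j).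

(** Only the first m diagonal entries have weight 1. A product of k + 1 entries along a path thus
    has weight k + 1 only if the path stays at one of these indices. *)
Lemma wspan_expmx_diag k a b :
  wspan k k.+1 (fun g => (R g ^+ k.+1) a b - (R g a a ^+ k.+1) *+ ((a == b) && (a < m)%N)).
Proof.
elim: k b => [|k IH] b.
  case: (boolP ((a == b) && (a < m)%N)) (R_sp a b) => [/andP[/eqP -> _] _|_].
    by apply: eq_spanned (spanned0 _ _) => g; rewrite !expr1 subrr.
  by apply: eq_spanned => g; rewrite expr1 subr0.
set E := fun g c => R g a a ^+ k.+1 *+ ((a == c) && (a < m)%N).
apply: (@eq_spanned _ _ _ _ _ (fun g =>
  \sum_c ((R g ^+ k.+1) a c - E g c) * R g c b +
  (E g a * R g a b - (R g a a ^+ k.+2) *+ ((a == b) && (a < m)%N)))).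
  move=> g; rewrite addrA; congr (_ - _).
  rewrite [in RHS]exprSr -[_ * R g]/(_ *m R g) mxE [in RHS](eq_bigr (fun c =>
    ((R g ^+ k.+1) a c - E g c) * R g c b + E g c * R g c b)); last first.
    by move=> c _; rewrite -mulrDl subrK.
  rewrite big_split /=; congr (_ + _); rewrite (bigD1 a) //= big1 ?addr0 // => c ca.
  by rewrite /E eq_sym (negPf ca) mul0r.
apply: spannedD.
  apply: spanned_sum => c _.
  apply: wspan_le (wspanM (IH c) (R_sp c b)); rewrite ?addn1 //.
  by rewrite -[X in (_ <= X)%N]addn1 leq_add2l; case: (_ && _).
rewrite /E eqxx /=; case: (ltnP a m) => am; last first.
  rewrite andbF; apply: eq_spanned (spanned0 _ _) => g.
  by rewrite !mulr0n mul0r subr0.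
have [<-|ab] := eqVneq a b.
  by apply: eq_spanned (spanned0 _ _) => g; rewrite !mulr1n -exprSr subrr.
have Raa : wspan 1 1 (fun g => R g a a) by have := R_sp a a; rewrite eqxx am.
have := wspanM (wspan_exp k.+1 Raa) (R_sp a b).
rewrite (negPf ab) !muln1 addn0 addn1.
by apply: eq_spanned => g; rewrite subr0.
Qed.

Variable B : 'M[K]_m.+1.
Hypothesis B_diag : forall i : 'I_m.+1, (i < m)%N -> B i i = 1.
Hypothesis BR : forall k g, \tr (B *m R g ^+ k) = 0.
Hypothesis m_char : forall k, (0 < k <= m)%N -> k%:R != 0 :> K.

Let x (i : 'I_m) g := R g (widen_ord (leqnSn m) i) (widen_ord (leqnSn m) i).

(* Modulo terms of lower weight, the equation [BR] says that a power sum vanishes. *)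
Lemma wspan_power_sum k : wspan k k.+1 (fun g => \sum_i x i g ^+ k.+1).
Proof.
pose L g a b := (R g ^+ k.+1) a b - (R g a a ^+ k.+1) *+ ((a == b) && (a < m)%N).
apply: (@eq_spanned _ _ _ _ _ (fun g => - \sum_a \sum_b B a b * L g b a)); last first.
  apply: spannedN; apply: spanned_sum => a _; apply: spanned_sum => b _.
  apply: spannedZ; exact: wspan_expmx_diag.
move=> g; have := BR k.+1 g; rewrite /mxtrace.
under eq_bigr do rewrite mxE.
rewrite (eq_bigr (fun a => \sum_b B a b * L g b a + (R g a a ^+ k.+1) *+ (a < m)%N)).
  rewrite big_split /= => /eqP; rewrite addr_eq0 => /eqP ->; rewrite opprK.
  rewrite big_ord_recr /= ltnn addr0; apply: eq_bigr => i _.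
  by rewrite /= ltn_ord.
move=> a _; rewrite (eq_bigr (fun b => B a b * L g b a +
    B a b * ((R g b b ^+ k.+1) *+ ((b == a) && (b < m)%N)))); last first.
  by move=> b _; rewrite -mulrDr subrK.
rewrite big_split /=; congr (_ + _).
rewrite (bigD1 a) //= big1 ?addr0 => [|b /negPf ->]; last by rewrite mulr0.
by rewrite eqxx /=; case: ltnP => am; rewrite ?mulr0 // B_diag // mul1r.
Qed.

(** Since the power sums have low weight, Newton's identities lower the weight of each nonleading
    coefficient of the polynomial with roots [x i]. Solving the equation of [x i] for its leading
    term gives the claim. *)
Lemma wspan_diag_exp (i : 'I_m) : wspan m.-1 m (fun g => x i g ^+ m).
Proof.
pose r := [seq x i | i <- enum 'I_m].
have sr : size r = m by rewrite size_map size_enum_ord.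
pose f g := \prod_(y <- [seq h g | h <- r]) ('X - y%:P).
have x_sp j : wspan 1 1 (x j).
  by have := R_sp (widen_ord (leqnSn m) j) (widen_ord (leqnSn m) j); rewrite eqxx /= ltn_ord.
have f_sp k : wspan (m - k) (m - k) (fun g => (f g)`_k).
  rewrite -sr; apply: wspan_coef_prod_XsubC => j jr.
  by rewrite (nth_map i) ?x_sp // -(size_map x).
have p_sp k : wspan k k.+1 (fun g => power_sum [seq h g | h <- r] k.+1).
  apply: eq_spanned (wspan_power_sum k) => g.
  by rewrite /power_sum !big_map -[RHS]big_enum /= big_enum.
have lo a : (a < m)%N -> wspan (m - a).-1 (m - a) (fun g => (f g)`_a).
  move=> am; apply: (@eq_spanned _ _ _ _ _ (fun g => ((m - a)%:R)^-1 *
     - \sum_(j < m - a) (f g)`_(a.+1 + j) * power_sum [seq h g | h <- r] j.+1)).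
    move=> g; have := @newton K [seq h g | h <- r] a; rewrite size_map sr => <-; last exact: ltnW.
    by rewrite mulKf // m_char // subn_gt0 am leq_subr.
  apply: spannedZ; apply: spannedN; apply: spanned_sum => j _.
  apply: wspan_le (wspanM (f_sp _) (p_sp j)); have := ltn_ord j; lia.
apply: (@eq_spanned _ _ _ _ _ (fun g => - \sum_(a < m) (f g)`_a * x i g ^+ a)).
  move=> g; have : (f g).[x i g] = 0.
    apply/eqP; rewrite -rootE root_prod_XsubC -map_comp.
    by apply/mapP; exists i; rewrite ?mem_enum.
  have sf : size (f g) = m.+1 by rewrite size_prod_XsubC size_map sr.
  rewrite horner_coef sf big_ord_recr /= => /eqP; rewrite addrC addr_eq0.
  have -> : (f g)`_m = 1.
    by rewrite -[m]/(m.+1.-1) -sf; apply: (monicP (monic_prod_XsubC _ _ _)).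
  by rewrite mul1r => /eqP.
apply: spannedN; apply: spanned_sum => a _.
apply: wspan_le (wspanM (lo a (ltn_ord a)) (wspan_exp a (x_sp i))); have := ltn_ord a; lia.
Qed.

End Relations.

(** * Cyclic matrices *)

Section Cyclic.
Variable K : fieldType.

Definition krylov n (v : 'rV[K]_n.+1) (R : 'M[K]_n.+1) (k : nat) : 'M[K]_(k, n.+1) :=
  \matrix_(i < k) (v *m R ^+ i).

(** This is the condition that v, v R, ..., v R^n form a basis; [cyclic_free] turns it into a
    nonvanishing determinant. *)
Definition cyclic n (v : 'rV[K]_n.+1) (R : 'M[K]_n.+1) :=
  forall f : {poly K}, (size f <= n.+1)%N -> v *m horner_mx R f = 0 -> f = 0.

Lemma horner_mx_wide n (R : 'M[K]_n.+1) (f : {poly K}) k : (size f <= k)%N ->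
  horner_mx R f = \sum_(i < k) f`_i *: R ^+ i.
Proof.
move=> fk; rewrite /horner_mx /horner_morph (horner_coef_wide _ (leq_trans (size_poly _ _) fk)).
apply: eq_bigr => i _; rewrite coef_map_id0 ?rmorph0 //.
by rewrite -scalemx1 -[_ * _]/(_ *m _) -scalemxAl mul1mx.
Qed.

Lemma mul_krylov n (v : 'rV[K]_n.+1) R k (u : 'rV[K]_k) :
  u *m krylov v R k = v *m horner_mx R (rVpoly u).
Proof.
rewrite mulmx_sum_row (@horner_mx_wide _ _ _ k) ?size_poly // mulmx_sumr.
apply: eq_bigr => i _; rewrite rowK -scalemxAr; congr (_ *: _).
by rewrite coef_rVpoly_ord.
Qed.

Lemma cyclic_free n (v : 'rV[K]_n.+1) R :
  reflect (cyclic v R) (krylov v R n.+1 \in unitmx).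
Proof.
rewrite -row_free_unit -kermx_eq0; apply: (iffP eqP) => [k0 f fn vf|cyc].
  have : poly_rV f *m krylov v R n.+1 = 0 by rewrite mul_krylov poly_rV_K.
  move/sub_kermxP; rewrite k0 submx0 => /eqP f0.
  by rewrite -(poly_rV_K fn) f0 linear0.
apply/eqP/rowV0P => u /sub_kermxP; rewrite mul_krylov => /cyc; rewrite size_poly => /(_ isT) u0.
by rewrite -[u]rVpolyK u0 linear0.
Qed.

(** A matrix commuting with R is determined by the image of v, so it suffices to match v X with some
    v f(R). *)
Lemma cyclic_poly n (v : 'rV[K]_n.+1) R X : cyclic v R -> X *m R = R *m X ->
  exists2 f : {poly K}, (size f <= n.+1)%N & X = horner_mx R f.
Proof.
move=> /cyclic_free kU XR.
pose u := v *m X *m invmx (krylov v R n.+1).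
exists (rVpoly u); first exact: size_poly.
have vX : v *m X = v *m horner_mx R (rVpoly u) by rewrite -mul_krylov mulmxKV.
apply: (can_inj (mulKmx kU)); apply/row_matrixP => i.
rewrite !row_mul rowK -!mulmxA.
have c1 : R ^+ i *m X = X *m R ^+ i.
  by apply/esym; apply: (@commrX _ X R i).
have c2 : R ^+ i *m horner_mx R (rVpoly u) = horner_mx R (rVpoly u) *m R ^+ i.
  by apply: comm_mx_horner; apply/esym; apply: (@commrX _ R R i).
by rewrite c1 c2 !mulmxA vX.
Qed.

(** Multiplying by h(R) keeps the first n + 1 - deg h Krylov rows independent: a relation would be a
    polynomial multiple of h of degree at most n killing v. *)
Lemma rank_horner_cyclic n (v : 'rV[K]_n.+1) R (h : {poly K}) : cyclic v R -> h != 0 ->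
  (n.+1 - (size h).-1 <= \rank (horner_mx R h))%N.
Proof.
move=> cyc h0; set k := (_ - _)%N.
apply: (@leq_trans (\rank (krylov v R k *m horner_mx R h))); last exact: mxrankM_maxr.
suff /eqP -> : row_free (krylov v R k *m horner_mx R h) by [].
rewrite -kermx_eq0; apply/rowV0P => u /sub_kermxP; rewrite mulmxA mul_krylov -mulmxA.
rewrite -[_ *m horner_mx R h]/(_ * _) -rmorphM => /cyc uh.
have [u0|u0] := eqVneq (rVpoly u) 0; first by rewrite -[u]rVpolyK u0 linear0.
have /eqP : rVpoly u * h = 0.
  apply: uh; rewrite size_mul //.
  have : (size (rVpoly u) <= k)%N by exact: size_poly.
  have : (0 < size (rVpoly u))%N by rewrite size_poly_gt0.
  have : (0 < size h)%N by rewrite size_poly_gt0.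
  have : (k = n.+1 - (size h).-1)%N by [].
  by clearbody k; move: (size (rVpoly u)) (size h) => a b; lia.
by rewrite mulf_eq0 (negPf u0) (negPf h0).
Qed.

Lemma horner_mx_sim m n (P : 'M[K]_(m.+1, n.+1)) (Q : 'M[K]_(n.+1, m.+1)) (D : 'M[K]_n.+1) f :
  Q *m P = 1%:M -> P *m Q = 1%:M -> horner_mx (P *m D *m Q) f = P *m horner_mx D f *m Q.
Proof.
move=> QP PQ; elim/poly_ind: f => [|f c IH]; first by rewrite !rmorph0 mulmx0 mul0mx.
rewrite !rmorphD !rmorphM /= !horner_mx_X !horner_mx_C IH mulmxDr mulmxDl; congr (_ + _).
  by rewrite -[LHS]/(_ *m _) -[horner_mx D f * D]/(_ *m _) !mulmxA -(mulmxA _ Q) QP mulmx1.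
by rewrite mul_mx_scalar -scalemxAl PQ scalemx1.
Qed.

Lemma horner_mx_block m n (A : 'M[K]_m.+1) (D : 'M[K]_n.+1) f :
  horner_mx (block_mx A 0 0 D : 'M_((m + n.+1).+1)) f =
    block_mx (horner_mx A f) 0 0 (horner_mx D f).
Proof.
elim/poly_ind: f => [|f c IH]; first by
  rewrite !rmorph0; apply/esym; apply: (@block_mx0 _ m.+1 n.+1 m.+1 n.+1).
rewrite !rmorphD !rmorphM /= !horner_mx_X !horner_mx_C IH.
transitivity (block_mx (horner_mx A f) 0 0 (horner_mx D f) *m block_mx A 0 0 D
    + block_mx c%:M 0 0 c%:M).
  by congr (_ + _); apply: (@scalar_mx_block _ m.+1 n.+1).
by rewrite mulmx_block !mulmx0 !mul0mx !addr0 add0r add_block_mx !addr0.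
Qed.

End Cyclic.

(** * Every matrix over a closed field commutes with a cyclic one *)

Section Closed.
Variable K : closedFieldType.

(** As in Euclid's argument, a root of 1 + prod (X - a) lies outside s. *)
Lemma exists_notin (s : seq K) : exists c, c \notin s.
Proof.
have [->|s0] := eqVneq s [::]; first by exists 0.
pose p := \prod_(a <- s) ('X - a%:P) + 1.
have : size p != 1%N.
  have wspan : (1 < size (\prod_(a <- s) ('X - a%:P))%R)%N.
    by rewrite size_prod_XsubC ltnS lt0n size_eq0.
  by rewrite size_polyDl ?size_poly1 // neq_ltn wspan orbT.
move=> /closed_rootP[c]; rewrite rootE hornerD hornerC => pc; exists c.
apply: contraTN pc; rewrite -root_prod_XsubC rootE => /eqP ->.
by rewrite add0r oner_eq0.
Qed.

Lemma cyclic_shift n (v : 'rV[K]_n.+1) R c : cyclic v R -> cyclic v (R + c%:M).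
Proof.
move=> cyc f fn; have -> : horner_mx (R + c%:M) f = horner_mx R (f \Po ('X + c%:P)).
  elim/poly_ind: f {fn} => [|f d IH]; first by rewrite comp_poly0 !rmorph0.
  rewrite comp_polyD comp_polyM comp_polyX comp_polyC !rmorphD !rmorphM /= IH.
  by rewrite !horner_mx_X !horner_mx_C rmorphD /= horner_mx_X horner_mx_C.
move=> /cyc; rewrite size_comp_poly2 ?size_XaddC // => /(_ fn) /eqP.
by rewrite comp_poly2_eq0 ?size_XaddC // => /eqP.
Qed.

(** By Cayley-Hamilton the remainder of f modulo the characteristic polynomial also kills v, and its
    degree is at most n. *)
Lemma cyclic_dvdp n (v : 'rV[K]_n.+1) R f : cyclic v R -> v *m horner_mx R f = 0 ->
  char_poly R %| f.
Proof.
move=> cyc; rewrite {1}(divp_eq f (char_poly R)) rmorphD rmorphM /=.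
rewrite Cayley_Hamilton mulr0 add0r => /cyc h; apply/eqP/h.
by rewrite -ltnS -(size_char_poly R) ltn_modp -size_poly_eq0 size_char_poly.
Qed.

Definition commutes_with_cyclic n (X : 'M[K]_n.+1) :=
  exists R v, X *m R = R *m X /\ cyclic v R.

(* Shifting the cyclic matrix of one block makes the two characteristic polynomials coprime. *)
Lemma cyclic_split n n1 n2 (X : 'M[K]_n.+1) (U1 : 'M[K]_(n1.+1, n.+1))
    (U2 : 'M[K]_(n2.+1, n.+1)) : (n1.+1 + n2.+1 = n.+1)%N ->
  row_free (col_mx U1 U2) -> stablemx U1 X -> stablemx U2 X ->
  (forall X', @commutes_with_cyclic n1 X') -> (forall X', @commutes_with_cyclic n2 X') ->
  commutes_with_cyclic X.
Proof.
move=> nE Qfree0; pose Q : 'M[K]_((n1 + n2.+1).+1, n.+1) := col_mx U1 U2.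
have Qfree : row_free Q by exact: Qfree0.
move=> /submxP[A1 UA1] /submxP[A2 UA2] IH1 IH2.
have [R1 [v1 [c1 cyc1]]] := IH1 A1; have [R2 [v2 [c2 cyc2]]] := IH2 A2.
have [P [QP PQ]] : exists P : 'M[K]_(n.+1, (n1 + n2.+1).+1), Q *m P = 1%:M /\ P *m Q = 1%:M.
  exists (pinvmx Q); split; first exact: mulmxVp.
  by apply: mulVpmx; rewrite /row_full -[X in _ == X]nE; exact: Qfree.
have [s1 s1E] := closed_field_poly_normal (char_poly R1).
have [s2 s2E] := closed_field_poly_normal (char_poly R2).
have lead_neq0 k (M : 'M[K]_k.+1) : lead_coef (char_poly M) != 0.
  by rewrite lead_coef_eq0 -size_poly_eq0 size_char_poly.
(* Avoiding all differences of eigenvalues keeps the spectra of R1 and R2 + c disjoint. *)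
have [c cP] := exists_notin [seq a - b | a <- s1, b <- s2].
pose R2' := R2 + c%:M.
have cyc2' : cyclic v2 R2' by exact: cyclic_shift.
have cop : coprimep (char_poly R1) (char_poly R2').
  apply: Pdiv.ClosedField.root_coprimep => x rx1; apply/negP.
  rewrite -rootE -eigenvalue_root_char => /eigenvalueP[w wx w0].
  have rx2 : root (char_poly R2) (x - c).
    rewrite -eigenvalue_root_char; apply/eigenvalueP; exists w => //.
    by rewrite scalerBl -wx mulmxDr mul_mx_scalar addrK.
  case/negP: cP; apply/allpairsP; exists (x, x - c) => /=; split; last by rewrite subKr.
    by move: rx1; rewrite s1E rootZ ?lead_neq0 // root_prod_XsubC.
  by move: rx2; rewrite s2E rootZ ?lead_neq0 // root_prod_XsubC.
pose D : 'M[K]_((n1 + n2.+1).+1) := block_mx R1 0 0 R2'.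
pose A : 'M[K]_((n1 + n2.+1).+1) := block_mx A1 0 0 A2.
have AD : A *m D = D *m A.
  rewrite /A /D !(@mulmx_block _ n1.+1 n2.+1 n1.+1 n2.+1 n1.+1 n2.+1).
  rewrite !mulmx0 !mul0mx !addr0 !add0r c1.
  suff -> : A2 *m R2' = R2' *m A2 by [].
  by rewrite mulmxDl mulmxDr c2 mul_mx_scalar mul_scalar_mx.
have XE : X = P *m A *m Q.
  rewrite -[LHS]mul1mx -PQ -!mulmxA; congr (_ *m _).
  have -> : A *m Q = col_mx (A1 *m U1) (A2 *m U2).
    have h := mul_block_col A1 0 0 A2 U1 U2.
    by rewrite !mul0mx addr0 add0r in h; exact: h.
  by rewrite -UA1 -UA2; exact: (mul_col_mx U1 U2 X).
pose v : 'rV[K]_((n1 + n2.+1).+1) := row_mx v1 v2.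
exists (P *m D *m Q), (v *m Q); split.
  rewrite XE !mulmxA -!(mulmxA _ Q P) QP !mulmx1 -!mulmxA.
  by rewrite [A *m (D *m _)]mulmxA AD !mulmxA.
move=> f fn; rewrite (@horner_mx_sim _ n (n1 + n2.+1) P Q D f) //.
rewrite !mulmxA -(mulmxA v Q P) QP mulmx1 => /(congr1 (mulmxr P)) /=.
rewrite -(mulmxA _ Q P) QP mulmx1 mul0mx /D horner_mx_block => vf0.
have := mul_row_block v1 v2 (horner_mx R1 f) 0 0 (horner_mx R2' f).
rewrite !mulmx0 addr0 add0r => /(etrans (esym vf0)) /esym.
rewrite -[RHS](@row_mx0 _ 1 n1.+1 n2.+1) => e; have [h1 h2] := @eq_row_mx K 1 n1.+1 n2.+1 _ _ _ _ e.
(* f is divisible by two coprime polynomials of total degree n + 1, which exceeds its own degree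
   unless f = 0. *)
have dvd : char_poly R1 * char_poly R2' %| f.
  by rewrite Gauss_dvdp // (cyclic_dvdp cyc1 h1) (cyclic_dvdp cyc2' h2).
apply/eqP; apply: contraTT isT => f0.
have := dvdp_leq f0 dvd; rewrite size_mul -?size_poly_eq0 ?size_char_poly //.
move=> le_f; have := leq_trans le_f fn; rewrite -nE; clear => *; exfalso; lia.
Qed.

(* If N ^ k phi <> 0 for the last nonzero power of N, the orbit of v under N has the annihilator of
   the orbit of phi as an invariant complement: the pairing of the orbits is antitriangular. *)
Lemma cyclic_nilpotent n (N : 'M[K]_n.+1) : N ^+ n.+1 = 0 ->
  (forall k, (k < n)%N -> forall X, @commutes_with_cyclic k X) -> commutes_with_cyclic N.
Proof.
move=> N0 IH; have ex : exists k, N ^+ k == 0 by exists n.+1; apply/eqP.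
case: (ex_minnP ex) => -[|k] /eqP Nk kmin; first by move/eqP: Nk; rewrite oner_eq0.
have kn : (k <= n)%N by rewrite -ltnS; apply: kmin; apply/eqP.
have [a [b Nab]] : exists a b, (N ^+ k) a b != 0.
  have : N ^+ k != 0 by apply/negP => /kmin; rewrite ltnn.
  case: (pickP (fun ij : 'I_n.+1 * 'I_n.+1 => (N ^+ k) ij.1 ij.2 != 0)) => [[a b] ? _|h].
    by exists a, b.
  case/eqP; apply/matrixP => i j; rewrite [RHS]mxE.
  by apply/eqP; have := h (i, j) => /negbFE.
pose v : 'rV[K]_n.+1 := delta_mx 0 a; pose phi : 'cV[K]_n.+1 := delta_mx b 0.
have Nge i : (k < i)%N -> N ^+ i = 0.
  by move=> ki; rewrite -(subnK ki) exprD Nk mulr0.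
pose U1 := krylov v N k.+1.
(* Listing the orbit of phi backwards makes the pairing triangular, with the nonzero entry (N^k)_ab
   along the diagonal. *)
pose Phi : 'M[K]_(n.+1, k.+1) := \matrix_(i, j) (N ^+ (k - j) *m phi) i 0.
have colPhi j : col j Phi = N ^+ (k - j) *m phi.
  by apply/colP => i; rewrite mxE [LHS]mxE.
have TE i j : (U1 *m Phi) i j = (N ^+ (i + (k - j))) a b.
  have -> : (U1 *m Phi) i j = (row i U1 *m col j Phi) 0 0.
    by rewrite !mxE; apply: eq_bigr => l _; rewrite !mxE.
  rewrite rowK colPhi mulmxA -(mulmxA v) -[_ *m N ^+ _]/(_ * _) -exprD.
  by rewrite -rowE -colE !mxE.
have Tunit : U1 *m Phi \in unitmx.
  rewrite unitmxE -det_tr det_trig; last first.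
    apply/is_trig_mxP => i j ij; rewrite mxE TE Nge ?mxE //.
    by have := ltn_ord j; lia.
  rewrite unitfE; apply/prodf_neq0 => i _; rewrite mxE TE subnKC //.
  by rewrite -ltnS.
have U1free (u : 'rV_k.+1) : u *m U1 = 0 -> u = 0.
  move=> uU; apply: (can_inj (mulmxK Tunit)).
  by rewrite mulmxA uU !mul0mx.
have rPhi : \rank Phi = k.+1.
  apply/eqP; rewrite eqn_leq rank_leq_col /=.
  by rewrite -{1}(mxrank_unit Tunit) mxrankM_maxr.
(* If k = n the orbit of v is the whole space and N itself is cyclic; otherwise the complement is
   nonzero and the splitting applies. *)
move: kn; rewrite leq_eqVlt => /orP[/eqP kE|kn].
  exists N, v; split=> //; apply/cyclic_free.
  rewrite -row_free_unit -kermx_eq0; apply/rowV0P => u /sub_kermxP.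
  by move: U1free; rewrite /U1 kE; apply.
have rk : \rank (kermx Phi) = (n - k.+1).+1 by rewrite mxrank_ker rPhi subSS subnSK.
have [U2 [U2free U2E]] : exists U2 : 'M[K]_((n - k.+1).+1, n.+1),
    row_free U2 /\ (U2 :=: kermx Phi)%MS.
  by rewrite -rk; exists (row_base (kermx Phi)); split; [exact: row_base_free|exact: eq_row_base].
apply: (@cyclic_split n k (n - k.+1) N U1 U2); first by lia.
- rewrite -kermx_eq0; apply/rowV0P => u /sub_kermxP.
  rewrite -[u]hsubmxK mul_row_col => uU.
  have U2Phi : U2 *m Phi = 0 by apply/sub_kermxP; rewrite U2E.
  have u1 : lsubmx u = 0.
    apply: (can_inj (mulmxK Tunit)); rewrite mul0mx.
    have := congr1 (mulmxr Phi) uU; rewrite /= mulmxDl mul0mx -!mulmxA U2Phi mulmx0 addr0.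
    exact.
  have u2 : rsubmx u = 0.
    apply: (row_free_inj U2free); rewrite mul0mx.
    by move: uU; rewrite u1 mul0mx add0r.
  by rewrite u1 u2 row_mx0.
- apply/row_subP => i; rewrite row_mul rowK -mulmxA -[_ *m N]/(_ * _) -exprSr.
  case: (ltnP i.+1 k.+1) => ik; last by rewrite Nge // mulmx0 sub0mx.
  by have := row_sub (Ordinal ik) U1; rewrite rowK.
- rewrite U2E; apply: submx_trans (submxMr _ _) _; first by rewrite U2E.
  apply/sub_kermxP/matrixP => i j; rewrite [RHS]mxE.
  suff /colP/(_ i) : col j (kermx Phi *m N *m Phi) = 0 by rewrite mxE => ->; rewrite mxE.
  have colM (A : 'M[K]_n.+1) l : col l (A *m Phi) = A *m col l Phi by rewrite !colE mulmxA.
  rewrite colM colPhi -[kermx Phi *m N *m _]mulmxA.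
  rewrite [N *m (_ *m _)]mulmxA -[N *m _]/(_ * _) -exprS.
  have [j0|j0] := posnP (j : nat).
    by rewrite j0 subn0 Nk mul0mx mulmx0.
  have jk : (j.-1 < k.+1)%N by apply: leq_ltn_trans (leq_pred _) (ltn_ord j).
  have -> : (k - j).+1 = (k - Ordinal jk)%N.
    by have := ltn_ord j; clear - j0 => /=; lia.
  by rewrite -colPhi -colM mulmx_ker; apply/colP => l; rewrite !mxE.
- by move=> X; apply: IH.
- by move=> X; apply: IH; lia.
Qed.

(** Strong induction on the size. With two distinct eigenvalues the space splits into stable pieces
    by coprime factors of the characteristic polynomial; with a single eigenvalue x, X - x is
    nilpotent. *)
Lemma closed_commutes_with_cyclic n (X : 'M[K]_n.+1) : commutes_with_cyclic X.
Proof.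
elim/ltn_ind: n X => n IH X.
have [x rx] : exists x, root (char_poly X) x by apply/closed_rootP; rewrite size_char_poly.
have chi0 : char_poly X != 0 by rewrite -size_poly_eq0 size_char_poly.
have [m [q qx chiE]] := multiplicity_XsubC (char_poly X) x.
rewrite chi0 /= in qx.
have m0 : (0 < m)%N.
  by case: m chiE => // chiE; move: qx; rewrite -(mulr1 q) -(expr0 ('X - x%:P)) -chiE rx.
have q0 : q != 0 by apply: contraNneq chi0 => q0; rewrite chiE q0 mul0r.
have [q1|q1] := eqVneq (size q) 1%N.
  have mE : m = n.+1.
    have := size_char_poly X; rewrite chiE size_Mmonic ?monic_exp ?monicXsubC // q1.
    by rewrite size_exp_XsubC add1n => -[].
  have [] := @cyclic_nilpotent n (X - x%:M).
  - have /size_poly1P[c c0 qE] : size q == 1%N by rewrite q1.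
    have := Cayley_Hamilton X; rewrite chiE qE mE rmorphM rmorphXn /= rmorphB /=.
    rewrite horner_mx_X !horner_mx_C -[_ * _]/(_ *m _) mul_scalar_mx => /eqP.
    by rewrite scaler_eq0 (negPf c0) => /eqP.
  - by move=> k kn X'; apply: IH.
  move=> R [v [RX cyc]]; exists R, v; split=> //.
  move: RX; rewrite mulmxBl mulmxBr mul_mx_scalar mul_scalar_mx => /eqP.
  by rewrite (inj_eq (addIr _)) => /eqP.
have cop : coprimep (('X - x%:P) ^+ m) q.
  by rewrite coprimep_expl // coprimep_sym coprimep_XsubC.
have pos p z : root (char_poly X) z -> root p z -> (0 < \rank (kermxpoly X p))%N.
  rewrite -eigenvalue_root_char => /eigenvalueP[w wX w0] /factor_theorem[p' ->].
  rewrite lt0n mxrank_eq0; apply: contraNneq w0 => k0.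
  rewrite -submx0 -k0; apply/sub_kermxP; rewrite mulrC rmorphM /= rmorphB /= horner_mx_X horner_mx_C.
  rewrite -[_ * horner_mx _ _]/(_ *m _) mulmxA mulmxBr wX mul_mx_scalar subrr mul0mx //.
have p1 : (0 < \rank (kermxpoly X (('X - x%:P) ^+ m)))%N.
  by apply: (pos _ x) => //; rewrite rootE horner_exp hornerXsubC subrr expr0n (gtn_eqF m0).
have p2 : (0 < \rank (kermxpoly X q))%N.
  have /closed_rootP[z rz] : size q != 1%N by [].
  by apply: (pos _ z) => //; rewrite chiE rootM rz.
have sumE : (\rank (kermxpoly X (('X - x%:P) ^+ m)) + \rank (kermxpoly X q))%N = n.+1.
  rewrite -mxrank_sum_cap mxdirect_kermxpoly // mxrank0 addn0.
  rewrite -(kermxpolyM _ cop) mulrC -chiE kermxpoly_min ?mxrank1 //.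
  exact: mxminpoly_dvd_char.
have split_base (E : 'M[K]_n.+1) : (0 < \rank E)%N ->
    exists U : 'M[K]_((\rank E).-1.+1, n.+1), (U :=: E)%MS.
  by case: (\rank E) (row_base E) (eq_row_base E) => // r U UE _; exists U.
have [U1 U1E] := split_base _ p1; have [U2 U2E] := split_base _ p2.
apply: (@cyclic_split n _ _ X U1 U2); first by rewrite !prednK.
- rewrite /row_free -addsmxE (adds_eqmx U1E U2E).
  have := mxrank_sum_cap (kermxpoly X (('X - x%:P) ^+ m)) (kermxpoly X q).
  by rewrite mxdirect_kermxpoly // mxrank0 addn0 !prednK // => ->.
- rewrite (eqmxMr _ U1E) U1E; exact: comm_mx_stable_kermxpoly.
- rewrite (eqmxMr _ U2E) U2E; exact: comm_mx_stable_kermxpoly.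
- by move=> X'; apply: IH; lia.
- by move=> X'; apply: IH; lia.
Qed.

End Closed.

(** * Parametrizing the matrices that commute with a cyclic one *)

Section Param.
Variable K : closedFieldType.

(** Write X = g(R). The gcd h of g - x and the characteristic polynomial of R satisfies rank h(R) <=
    n + 1 - r, so by cyclicity it has degree at least r; r of its roots serve as the [y i]. *)
Lemma cyclic_param n (v : 'rV[K]_n.+1) (R X : 'M[K]_n.+1) (x : K) r : cyclic v R ->
  X *m R = R *m X -> (r <= n.+1)%N -> (\rank (X - x%:M)%R <= n.+1 - r)%N ->
  exists (y : 'I_r -> K) (u : 'I_(n.+1 - r) -> K),
    (forall i, root (char_poly R) (y i)) /\
    X = x%:M + (\prod_i (R - (y i)%:M)) *m (\sum_k u k *: R ^+ k).
Proof.
move=> cyc /(cyclic_poly cyc)[g gn XE] rn rkX.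
set f := g - x%:P.
have fn : (size f <= n.+1)%N.
  by apply: leq_trans (size_polyD _ _) _; rewrite geq_max gn size_polyN (leq_trans (size_polyC_leq1 _)).
have fR : horner_mx R f = X - x%:M by rewrite rmorphB /= horner_mx_C -XE.
set chi := char_poly R.
have chi0 : chi != 0 by rewrite -size_poly_eq0 size_char_poly.
set h := gcdp f chi.
have h0 : h != 0 by rewrite gcdp_eq0 (negPf chi0) andbF.
have rkh : (\rank (horner_mx R h) <= n.+1 - r)%N.
  apply: leq_trans rkX; rewrite -fR.
  (* By Bezout and Cayley-Hamilton, h(R) is up to a nonzero scalar a multiple of f(R), so its rank
     is no larger. *)
  have [[/= a b] abE] := Bezoutp f chi; have /eqpf_eq[c c0 abcE] := abE.
  rewrite -(mxrank_scale_nz _ c0) -linearZ /= -abcE rmorphD !rmorphM /=.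
  by rewrite Cayley_Hamilton mulr0 addr0; exact: mxrankM_maxr.
have degh : (r < size h)%N.
  have := rank_horner_cyclic cyc h0; have : (0 < size h)%N by rewrite size_poly_gt0.
  move: (size h) (\rank _) rkh => a b; lia.
have [s hE] := closed_field_poly_normal h.
have lh0 : lead_coef h != 0 by rewrite lead_coef_eq0.
have ss : size h = (size s).+1 by rewrite {1}hE size_scale // size_prod_XsubC.
have rs : (r <= size s)%N by rewrite -ltnS -ss.
pose y (i : 'I_r) := s`_i.
have yE : \prod_(i < r) ('X - (y i)%:P) = \prod_(z <- take r s) ('X - z%:P).
  rewrite (big_nth 0) size_takel // big_mkord; apply: eq_bigr => i _.
  by rewrite nth_take.
have /dvdpP[q fE] : \prod_(i < r) ('X - (y i)%:P) %| f.
  apply: dvdp_trans (dvdp_gcdl f chi); rewrite -/h hE dvdpZr // yE.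
  by rewrite -{2}(cat_take_drop r s) big_cat dvdp_mulr.
have qn : (size q <= n.+1 - r)%N.
  have [->|q0] := eqVneq q 0; first by rewrite size_poly0.
  move: fn; rewrite fE size_mul //; last by rewrite yE -size_poly_eq0 size_prod_XsubC.
  rewrite yE size_prod_XsubC size_takel // addnS /= => h1.
  by rewrite leq_subRL // addnC.
exists y, (fun k => q`_k); split=> [i|].
  have : root h (y i).
    by rewrite hE rootZ // root_prod_XsubC mem_nth // (leq_trans (ltn_ord i)).
  by apply: root_dvdp; exact: dvdp_gcdr.
apply/eqP; rewrite addrC -subr_eq -fR fE mulrC rmorphM /= rmorph_prod /=.
rewrite (horner_mx_wide R qn); apply/eqP; congr (_ * _).
by apply: eq_bigr => i _; rewrite rmorphB /= horner_mx_X horner_mx_C.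
Qed.

End Param.

(** * The dimension of a centralizer *)

Section Dim.
Variable K : closedFieldType.

Lemma complete_row n (w : 'rV[K]_(1 + n)) : w != 0 ->
  exists2 P : 'M[K]_(1 + n), P \in unitmx & usubmx P = w.
Proof.
move=> w0; have rw : \rank w = 1%N by apply/eqP; rewrite rank_rV w0.
pose c := col_ebase w 0 0.
exists (block_mx c%:M 0 0 1%:M *m row_ebase w).
  rewrite unitmx_mul row_ebase_unit andbT unitmxE det_lblock det1 mulr1 det_scalar1.
  have := col_ebase_unit w; rewrite unitmxE.
  by rewrite {1}[col_ebase w]mx11_scalar det_scalar1.
rewrite /block_mx mul_col_mx col_mxKu -[RHS]mulmx_ebase rw [X in X *m pid_mx _]mx11_scalar.
congr (_ *m _); rewrite mul_scalar_mx pid_mx_row scale_row_mx scaler0.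
by rewrite scalemx1.
Qed.

(* Filter the target by a flag of U-stable lines: each quotient contributes a space of left
   eigenvectors of X. *)
Lemma rank_intertwiner m n r (U : 'M[K]_m) (X : 'M[K]_n) k (W : 'M[K]_(k, m * n)) :
  (forall x : K, (n - r <= \rank (X - x%:M)%R)%N) ->
  (forall Y, (mxvec Y <= W)%MS -> U *m Y = Y *m X) -> (\rank W <= m * r)%N.
Proof.
move=> rX; elim: m U k W => [|m IH] U k W WE; first exact: rank_leq_col.
have [x rx] : exists x, root (char_poly U) x by apply/closed_rootP; rewrite size_char_poly.
move: rx; rewrite -eigenvalue_root_char => /eigenvalueP[w wU w0].
have [P Pu Pw] := @complete_row m w w0.
(* The map Y -> w Y, for a left eigenvector w of U, takes values in left eigenvectors of X. On its
   kernel the first row of P Y vanishes, and the other rows intertwine a block of size m. *)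
pose f := lin1_mx (mulmx w \o vec_mx : 'rV[K]_(m.+1 * n) -> 'rV_n).
rewrite -(mxrank_mul_ker W f) [X in (_ <= X)%N]mulSn leq_add //.
  have : (W *m f <= kermx (X - x%:M))%MS.
    apply/sub_kermxP/row_matrixP => i; rewrite !row_mul row0 mul_rV_lin1 /=.
    have WX : U *m vec_mx (row i W) = vec_mx (row i W) *m X.
      by apply: WE; rewrite vec_mxK row_sub.
    by rewrite mulmxBr -mulmxA -WX mulmxA wU mul_mx_scalar -scalemxAl subrr.
  move/mxrankS/leq_trans; apply; rewrite mxrank_ker.
  by rewrite leq_subLR addnC -leq_subLR; exact: rX.
set W2 := (W :&: kermx f)%MS.
pose g := lin_mx (dsubmx \o (mulmx P : 'M_(1 + m, n) -> 'M_(1 + m, n))).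
have gE (Y : 'M_(1 + m, n)) : mxvec Y *m g = mxvec (dsubmx (P *m Y)) by rewrite mul_vec_lin.
have W2P (u : 'rV_(m.+1 * n)) : (u <= W2)%MS ->
    U *m vec_mx u = vec_mx u *m X /\ P *m vec_mx u = col_mx 0 (dsubmx (P *m (vec_mx u : 'M_(1 + m, n)))).
  rewrite sub_capmx => /andP[uW /sub_kermxP uf]; split; first by apply: WE; rewrite vec_mxK.
  rewrite -{1}[P *m _]vsubmxK; congr (col_mx _ _).
  rewrite -{1}[P]vsubmxK mul_col_mx col_mxKu Pw -[RHS]uf.
  by rewrite mul_rV_lin1.
have <- : \rank (W2 *m g) = \rank W2.
  rewrite -(mxrank_mul_ker W2 g) (_ : (W2 :&: kermx g)%MS = 0) ?mxrank0 ?addn0 //.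
  apply/eqP/rowV0P => u; rewrite sub_capmx => /andP[/W2P[_ Pu0] /sub_kermxP].
  rewrite -[u]vec_mxK gE => /(congr1 vec_mx); rewrite mxvecK linear0 => d0.
  suff -> : vec_mx u = 0 by rewrite linear0.
  by apply: (can_inj (mulKmx Pu)); rewrite Pu0 d0 mulmx0 col_mx0.
pose U' := P *m U *m invmx P : 'M_(1 + m).
apply: (IH (drsubmx U')) => Y /submxP[D DE].
pose u := D *m W2; have uW2 : (u <= W2)%MS by exact: submxMl.
have [UX Pu0] := W2P u uW2.
have YE : Y = dsubmx (P *m (vec_mx u : 'M_(1 + m, n))).
  by apply: (can_inj mxvecK); rewrite -gE vec_mxK /u -mulmxA.
rewrite -YE in Pu0.
have : U' *m (P *m vec_mx u) = (P *m vec_mx u) *m X.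
  by rewrite /U' !mulmxA mulmxKV // -!mulmxA UX.
rewrite Pu0 -{1}[U']submxK mul_block_col !mulmx0 !add0r mul_col_mx.
by move=> /eq_col_mx[].
Qed.

Lemma rank_cent n r (X : 'M[K]_n) :
  (forall x : K, (n - r <= \rank (X - x%:M)%R)%N) -> (\rank 'C(mxvec X)%MS <= n * r)%N.
Proof.
move=> rX; apply: (rank_intertwiner (U := X) rX) => Y.
by move=> /cent_mxP ->; rewrite ?submx_refl.
Qed.

End Dim.

(** * Cyclic matrices with prescribed coordinates in a centralizer *)

Section Grid.
Variables (F K : fieldType) (f : {rmorphism F -> K}).

(** Being a polynomial of degree at most D in each of the d coordinates separately is enough to fix
    the coordinates one after the other. *)
Definition sep_poly d D (g : seq K -> K) := forall t1 t2, (size t1 + (size t2).+1 = d)%N ->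
  exists2 q : {poly K}, (size q <= D.+1)%N & forall c, g (t1 ++ c :: t2) = q.[c].

Lemma wspan_sep_poly d D (g : seq K -> K) :
  wspan (fun (i : 'I_d) (s : seq K) => s`_i) (fun=> 0%N) 0 D g -> sep_poly d D g.
Proof.
move=> [s [sD gE]] t1 t2 td.
have k0d : (size t1 < d)%N by rewrite -td -addSnnS leq_addr.
pose k0 := Ordinal k0d.
pose q := \sum_(t <- s) (t.1 * \prod_(i | i != k0) (t1 ++ 0 :: t2)`_i ^+ t.2 i) *: 'X^(t.2 k0).
exists q => [|c].
  rewrite /q big_seq; apply: (leq_trans (size_sum _ _ _)); apply/bigmax_leqP_seq => t ts _.
  apply: leq_trans (size_scale_leq _ _) _; rewrite size_polyXn ltnS.
  have /andP[tD _] := allP sD _ ts; apply: leq_trans tD.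
  by rewrite /deg (bigD1 k0) //= leq_addr.
rewrite gE /q horner_sum; apply: eq_bigr => t _.
rewrite hornerZ hornerXn /monom (bigD1 k0) //= nth_cat ltnn subnn /= mulrA [RHS]mulrAC.
congr (_ * _); apply: eq_bigr => i ik; rewrite !nth_cat; case: ifP => // it.
have : (i - size t1 != 0)%N.
  rewrite subn_eq0 -ltnNge ltn_neqAle leqNgt it andbT eq_sym.
  by apply: contra ik => /eqP ie; apply/eqP/val_inj.
by case: (_ - _)%N.
Qed.

(** A quantitative Schwartz-Zippel lemma: given a nonzero value over K, each coordinate in turn can
    be moved into S, at most D choices being excluded. *)
Lemma nonzero_grid (S : seq F) d D (g : seq K -> K) (s0 : seq K) : uniq S ->
  sep_poly d D g -> size s0 = d -> g s0 != 0 ->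
  exists L : seq (seq F), [/\ uniq L, ((size S - D) ^ d <= size L)%N &
    forall t, t \in L -> [/\ size t = d, {subset t <= S} & g (map f t) != 0]].
Proof.
move=> uS; elim: d g s0 => [|d IH] g s0 gsep ss g0.
  exists [:: [::]]; split=> // t; rewrite inE => /eqP ->; split=> //.
  by move: ss g0; case: s0.
case: s0 ss g0 => // a s0 [ss] g0.
have [q qD qE] := gsep [::] s0 (congr1 succn ss).
have q0 : q != 0 by apply: contraNneq g0 => q0; have := qE a; rewrite q0 horner0 /= => ->.
pose C := [seq c <- S | q.[f c] != 0].
have sC : (size S - D <= size C)%N.
  rewrite leq_subLR -(count_predC (fun c => q.[f c] == 0) S) -!size_filter leq_add //.
  rewrite -ltnS; apply: leq_trans qD.
  rewrite -(size_map f); apply: max_poly_roots => //.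
    by apply/allP => x /mapP[c]; rewrite mem_filter => /andP[qc _] ->.
  by rewrite map_inj_uniq ?filter_uniq //; exact: fmorph_inj.
have HC c : c \in C -> exists L : seq (seq F), [/\ uniq L, ((size S - D) ^ d <= size L)%N &
    forall t, t \in L -> [/\ size t = d, {subset t <= S} & g (map f (c :: t)) != 0]].
  rewrite mem_filter => /andP[qc cS]; apply: (IH (fun t => g (f c :: t)) s0) => //; last first.
    by have := qE (f c); rewrite /= => ->.
  move=> t1 t2 td; have [|p pD pE] := gsep (f c :: t1) t2; first by rewrite /= addSn td.
  by exists p.
(* Recording the head of each list keeps the pieces belonging to different values of the first
   coordinate disjoint. *)
suff [L [uL sL LP]] : exists L : seq (seq F),
    [/\ uniq L, (size C * (size S - D) ^ d <= size L)%N &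
    forall t, t \in L -> [/\ size t = d.+1, {subset t <= S} & g (map f t) != 0]
      /\ head 0 t \in C].
  exists L; split=> // [|t /LP[] //]; rewrite expnS (leq_trans _ sL) // leq_mul2r sC orbT //.
have : {subset C <= S} by move=> c; rewrite mem_filter => /andP[].
have : uniq C by rewrite filter_uniq.
elim: C HC {sC} => [|c C IHC] HC; first by exists [::].
move=> /= /andP[cC uC] CS.
have [||L [uL sL LP]] := IHC _ uC.
- by move=> c' c'C; apply: HC; rewrite inE c'C orbT.
- by move=> c' c'C; apply: CS; rewrite inE c'C orbT.
have [Lc [uLc sLc LcP]] := HC c (mem_head _ _).
exists ([seq c :: t | t <- Lc] ++ L); split.
- rewrite cat_uniq uL map_inj_uniq ?uLc; last by move=> x y [].
  rewrite andbT /=; apply/hasPn => t /LP[_ tC]; apply/mapP => -[t' _ tE].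
  by move: tC; rewrite tE /= (negPf cC).
- by rewrite size_cat size_map mulSn leq_add.
move=> t; rewrite mem_cat => /orP[/mapP[t' /LcP[st tS gt] ->]|/LP[h hC]].
  split; last exact: mem_head.
  split=> //=; first by rewrite st.
  by move=> x; rewrite inE => /orP[/eqP ->|/tS //]; apply: CS; exact: mem_head.
by split=> //; rewrite inE hC orbT.
Qed.

End Grid.

Section Centralizer.
Variables (F : fieldType) (K : closedFieldType) (f : {rmorphism F -> K}).

Lemma wspan_krylov (V : finType) (G : Type) (v : V -> G -> K) n a d (u : 'rV[K]_n.+1)
    (R : G -> 'M[K]_n.+1) : (forall i j, wspan v (fun=> 0%N) a d (fun g => R g i j)) ->
  wspan v (fun=> 0%N) (n.+1 * (n.+1 * a)) (n.+1 * (n.+1 * d)) (fun g => \det (krylov u (R g) n.+1)).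
Proof.
move=> Rsp; apply: wspan_det => i j.
apply: (@eq_spanned _ _ _ _ _ (fun g => \sum_k u 0 k * (R g ^+ i) k j)).
  by move=> g; rewrite !mxE.
apply: spanned_sum => k _; apply: spannedZ.
by apply: wspan_le (wspan_expmx Rsp i k j); rewrite leq_mul2r ltnW ?orbT.
Qed.

Lemma cent1P (E : fieldType) n (X Y : 'M[E]_n) :
  reflect (X *m Y = Y *m X) (mxvec Y <= 'C(mxvec X))%MS.
Proof.
apply: (iffP cent_rowP) => [/(_ 0)|XY i]; first by rewrite row_id mxvecK.
by rewrite (ord1 i) row_id mxvecK.
Qed.

(** A basis of the row space normalized to the identity on the columns [iota], as in reduced echelon
    form: these coordinates are free and determine the vector. *)
Lemma row_coordinates (E : fieldType) p n (A : 'M[E]_(p, n)) :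
  exists (iota : 'I_(\rank A) -> 'I_n) (psi : 'M[E]_(\rank A, n)),
  [/\ injective iota, (psi :=: A)%MS & forall (u : 'rV_(\rank A)) i, (u *m psi) 0 (iota i) = u 0 i].
Proof.
have Bfull : row_full (row_base A)^T by rewrite /row_full mxrank_tr; exact: row_base_free.
pose M := rowsub (fullrankfun Bfull) (row_base A)^T.
have Mu : M^T \in unitmx by rewrite unitmx_tr; exact: fullrowsub_unit.
exists (fullrankfun Bfull), (invmx M^T *m row_base A); split.
- exact: fullrankfun_inj.
- apply: eqmx_trans (eq_row_base A); apply: eqmxMfull.
  by rewrite row_full_unit unitmx_inv.
move=> u i; rewrite mulmxA -[RHS](congr1 (fun v : 'rV_(\rank A) => v 0 i) (mulmxKV Mu u)).
by rewrite !mxE; apply: eq_bigr => j _; rewrite !mxE.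
Qed.

(** In coordinates on the centralizer the Krylov determinant is a polynomial of degree at most the
    square of the matrix size. It does not vanish identically over K, so it is nonzero at many
    points of the grid over S. *)
Lemma cyclic_grid n (X : 'M[F]_n.+1) (S : seq F) : uniq S ->
  exists (J : {set 'I_n.+1 * 'I_n.+1}) (L : seq 'M[F]_n.+1),
  [/\ uniq L, ((size S - n.+1 * n.+1) ^ \rank 'C(mxvec X)%MS <= size L)%N,
      #|J| = \rank 'C(mxvec X)%MS,
      (forall R, R \in L -> [/\ X *m R = R *m X, forall ij, ij \in J -> R ij.1 ij.2 \in S &
        exists v, cyclic v (map_mx f R)]) &
      (forall R R', R \in L -> R' \in L -> (forall ij, ij \in J -> R ij.1 ij.2 = R' ij.1 ij.2) ->
        R = R')].
Proof.
move=> uS; have [iota [psi [iota_inj psiE psi_coord]]] := row_coordinates 'C(mxvec X)%MS.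
set d := \rank _ in iota psi iota_inj psiE psi_coord *.
have /fin_all_exists[io ioE] : forall k, exists ij : 'I_n.+1 * 'I_n.+1,
    iota k = mxvec_index ij.1 ij.2.
  move=> k; case: (mxvec_indexP (iota k)) => i j.
  by exists (i, j).
have io_inj : injective io by move=> i j e; apply: iota_inj; rewrite !ioE e.
pose R_ (u : 'rV[F]_d) : 'M[F]_n.+1 := vec_mx (u *m psi).
have R_coord u k : R_ u (io k).1 (io k).2 = u 0 k by rewrite mxE -ioE psi_coord.
have R_cent u : X *m R_ u = R_ u *m X.
  by apply/cent1P; rewrite vec_mxK -psiE submxMl.
have [R0 [v [XR0 cyc]]] := closed_commutes_with_cyclic (map_mx f X).
have [u0 R0E] : exists u0 : 'rV[K]_d, R0 = vec_mx (u0 *m map_mx f psi).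
  have : (mxvec R0 <= map_mx f psi)%MS.
    apply: (@submx_trans _ _ _ _ _ _ (map_mx f 'C(mxvec X)%MS)).
      by rewrite map_cent_mx map_mxvec; apply/cent1P.
    by rewrite map_submx psiE.
  by case/submxP => u uE; exists u; rewrite -uE mxvecK.
pose g (t : seq K) := \det (krylov v (vec_mx (\row_(k < d) t`_k *m map_mx f psi)) n.+1).
have g_sep : sep_poly d (n.+1 * n.+1) g.
  apply: wspan_sep_poly; rewrite -[X in wspan _ _ _ (_ * X)%N]muln1.
  rewrite -[X in wspan _ _ X](muln0 n.+1) -[X in wspan _ _ (_ * X)%N](muln0 n.+1).
  apply: wspan_krylov => i j.
  apply: (@eq_spanned _ _ _ _ _ (fun t : seq K =>
    \sum_(k < d) f (psi k (mxvec_index i j)) * t`_k)).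
    by move=> t; rewrite !mxE; apply: eq_bigr => k _; rewrite !mxE mulrC.
  by apply: spanned_sum => k _; apply: spannedZ; exact: wspan_var.
have [||L [uL sL LP]] := @nonzero_grid F K f S d _ g [seq u0 0 k | k <- enum 'I_d] uS g_sep.
- by rewrite size_map size_enum_ord.
- rewrite /g (_ : \row_k _ = u0) -?R0E.
    by rewrite -unitfE -unitmxE; apply/cyclic_free.
  by apply/rowP => k; rewrite mxE (nth_map k) ?size_enum_ord // nth_ord_enum.
pose toR (t : seq F) := R_ (\row_k t`_k).
have toR_inj : {in L &, injective toR}.
  move=> t t' /LP[st _ _] /LP[st' _ _] e; apply: (@eq_from_nth _ 0); first by rewrite st st'.
  move=> i; rewrite st => id; have := R_coord (\row_k t`_k) (Ordinal id).
  by rewrite -/(toR t) e R_coord !mxE /= => ->.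
exists (io @: setT), [seq toR t | t <- L]; split.
- by rewrite map_inj_in_uniq.
- by rewrite size_map.
- by rewrite card_imset // cardsT card_ord.
- move=> R /mapP[t tL ->]; have [st tS gt] := LP t tL; split; first exact: R_cent.
    by move=> _ /imsetP[k _ ->]; rewrite R_coord mxE tS // mem_nth // st.
  exists v; apply/cyclic_free; rewrite unitmxE unitfE.
  move: gt; rewrite /g; congr (\det (krylov v _ _) != 0).
  rewrite /toR /R_ map_vec_mx map_mxM; congr (vec_mx (_ *m _)).
  by apply/rowP => k; rewrite !mxE (nth_map 0) // st.
move=> R R' /mapP[t tL ->] /mapP[t' t'L ->] e; congr (toR _).
have [st _ _] := LP t tL; have [st' _ _] := LP t' t'L.
apply: (@eq_from_nth _ 0); first by rewrite st st'.
move=> i; rewrite st => id.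
have := e (io (Ordinal id)); rewrite imset_f ?inE // => /(_ isT).
by rewrite !R_coord !mxE.
Qed.

(** r is attained at an eigenvalue over K; at other scalars X - x is invertible, so r bounds every
    nullity and [rank_cent] applies. *)
Lemma exists_max_nullity n (X : 'M[F]_n.+1) :
  exists r, [/\ (0 < r <= n.+1)%N,
    exists x : K, (\rank (map_mx f X - x%:M)%R <= n.+1 - r)%N &
    (\rank 'C(mxvec X)%MS <= n.+1 * r)%N].
Proof.
set Y := map_mx f X.
have [s sE] := closed_field_poly_normal (char_poly Y).
have chi0 : char_poly Y != 0 by rewrite -size_poly_eq0 size_char_poly.
have sP x : (x \in s) = eigenvalue Y x.
  by rewrite eigenvalue_root_char sE rootZ ?lead_coef_eq0 // root_prod_XsubC.
pose P k := has (fun x => \rank (Y - x%:M)%R == k) s.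
have exP : exists k, P k.
  have [x rx] : exists x, root (char_poly Y) x by apply/closed_rootP; rewrite size_char_poly.
  exists (\rank (Y - x%:M)%R); apply/hasP; exists x => //.
  by rewrite sP eigenvalue_root_char.
case: (ex_minnP exP) => k /hasP[x xs /eqP xk] kmin.
have kn : (k < n.+1)%N.
  rewrite -xk ltn_neqAle rank_leq_row andbT -/(row_free _).
  rewrite -kermx_eq0; move: xs; rewrite sP.
  by rewrite /eigenvalue /eigenspace => ->.
exists (n.+1 - k)%N; split; first by rewrite subn_gt0 kn leq_subr.
  by exists x; rewrite xk subKn // ltnW.
rewrite -(mxrank_map f) map_cent_mx map_mxvec; apply: rank_cent => y.
rewrite subKn; last exact: ltnW.
have [ys|] := boolP (y \in s).
  by apply: kmin; apply/hasP; exists y.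
rewrite sP /eigenvalue negbK /eigenspace kermx_eq0 => /eqP ->; exact: ltnW.
Qed.

End Centralizer.

(** * Counting pairs of a matrix and a cyclic matrix commuting with it *)

Section Eigenvalue.
Variables (K : fieldType) (V : finType) (G : Type) (v : V -> G -> K) (w : V -> nat).
Local Notation wspan := (wspan v w).

(** With y of weight 2 and the [a i] of weight 1, the power of y is the only term of the product of
    full weight. *)
Lemma wspan_prod_sub (p : nat) (y : G -> K) (a : 'I_p -> G -> K) :
  wspan 2 1 y -> (forall i, wspan 1 1 (a i)) -> (0 < p)%N ->
  wspan (2 * p).-1 p (fun g => \prod_i (y g - a i g) - y g ^+ p).
Proof.
move=> ysp; elim: p a => // p IH a asp _.
have prodsp : wspan (p * 2) p (fun g => \prod_(i < p) (y g - a (lift ord0 i) g)).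
  have := @wspan_prod _ _ _ v w _ (index_enum 'I_p) xpredT (fun=> 2) (fun=> 1)
    (fun i g => y g - a (lift ord0 i) g).
  rewrite !sum_nat_const card_ord muln1; apply=> i _.
  by apply: spannedB => //; exact: wspan_le (asp _).
apply: (@eq_spanned _ _ _ _ _ (fun g =>
   y g * (\prod_(i < p) (y g - a (lift ord0 i) g) - y g ^+ p) -
   a ord0 g * \prod_(i < p) (y g - a (lift ord0 i) g))).
  by move=> g; rewrite big_ord_recl mulrBr -exprS mulrBl addrAC.
apply: spannedB.
  case: p IH a asp prodsp => [|p] IH a asp _.
    by apply: eq_spanned (spanned0 _ _) => g; rewrite big_ord0 expr0 subrr mulr0.
  by apply: wspan_le (wspanM ysp (IH _ (fun i => asp (lift ord0 i)) isT)); lia.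
by apply: wspan_le (wspanM (asp ord0) prodsp); lia.
Qed.

(** In the expansion of the determinant, a permutation other than the identity moves some index,
    whose factor has weight 1 instead of 2. *)
Lemma wspan_eigenvalue p (y : G -> K) (A : G -> 'M[K]_p.+1) :
  wspan 2 1 y -> (forall i j, wspan 1 1 (fun g => A g i j)) ->
  (forall g, \det ((y g)%:M - A g) = 0) ->
  wspan (2 * p.+1).-1 p.+1 (fun g => y g ^+ p.+1).
Proof.
move=> ysp Asp detA.
pose M g i j := ((y g)%:M - A g) i j.
have Msp i j : wspan (1 + (i == j)) 1 (fun g => M g i j).
  apply: (@eq_spanned _ _ _ _ _ (fun g => y g *+ (i == j) - A g i j)); first by move=> g; rewrite /M !mxE.
  have [->|ij] := eqVneq i j; last first.
    by apply: eq_spanned (spannedN (Asp i j)) => g; rewrite sub0r.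
  by apply: spannedB => //; exact: wspan_le (Asp j j).
apply: (@eq_spanned _ _ _ _ _ (fun g => - ((\prod_i (y g - A g i i) - y g ^+ p.+1) +
   \sum_(s : {perm 'I_p.+1} | s != 1%g) (-1) ^+ s * \prod_i M g i (s i)))).
  move=> g; have := detA g; rewrite /determinant (bigD1 1%g) //= odd_perm1 expr0 mul1r.
  rewrite (eq_bigr (fun i => y g - A g i i)); last by move=> i _; rewrite perm1 !mxE eqxx.
  by rewrite addrAC => ->; rewrite sub0r opprK.
apply: spannedN; apply: spannedD.
  by apply: wspan_prod_sub => // i.
apply: spanned_sum => s s1; apply: spannedZ.
have := @wspan_prod _ _ _ v w _ (index_enum 'I_p.+1) xpredT (fun i => (1 + (i == s i))%N) (fun=> 1)
    (fun i g => M g i (s i)) (fun i _ => Msp i (s i)).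
apply: wspan_le; last by rewrite sum_nat_const card_ord muln1.
have [i si] : exists i, i != s i.
  case: (pickP (fun i => i != s i)) => [i ? |h]; first by exists i.
  by case/eqP: s1; apply/permP => i; rewrite perm1; have := h i => /negbFE/eqP.
rewrite (bigD1 i) //= (negPf si) addn0.
have : (\sum_(j | j != i) (1 + (j == s j)) <= \sum_(j : 'I_p.+1 | j != i) 2)%N.
  by apply: leq_sum => j _; case: (_ == _).
rewrite sum_nat_const cardC1 card_ord /=; lia.
Qed.

Lemma wspan_prodmx n a b r (A : 'I_r -> G -> 'M[K]_n) :
  (forall k i j, wspan a b (fun g => A k g i j)) ->
  forall i j, wspan (r * a) (r * b) (fun g => (\prod_k A k g) i j).
Proof.
elim: r A => [|r IH] A hA i j.
  by apply: eq_spanned (wspan_const _ _ _ _ (i == j)%:R) => g; rewrite big_ord0 mxE.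
rewrite !mulSn; apply: eq_spanned (wspan_mulmx (hA ord0) (IH _ (fun k => hA (lift ord0 k))) i j) => g.
by rewrite big_ord_recl.
Qed.

End Eigenvalue.

Section Pairs.
Variables (F : fieldType) (K : closedFieldType) (f : {rmorphism F -> K}).
Local Notation "A ^f" := (map_mx f A) : ring_scope.

(* The parameters are the entries of Q R P, the y_i, x and u_k of [cyclic_param]; [b] records
   whether the trace conditions are used, in which case m diagonal entries are integral. *)
Lemma card_pairs_le m r (S : seq F) (J : {set 'I_m.+1 * 'I_m.+1}) (b : bool)
    (P Q : 'M[K]_m.+1) (B : 'M[F]_m.+1) (G : finType) (X R : G -> 'M[F]_m.+1) :
  (0 < r <= m.+1)%N ->
  (forall g i j, X g i j \in S) ->
  (forall g ij, ij \in J -> R g ij.1 ij.2 \in S) ->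
  (forall g g', X g = X g' -> (forall ij, ij \in J -> R g ij.1 ij.2 = R g' ij.1 ij.2) -> g = g') ->
  (forall g, X g *m R g = R g *m X g) ->
  (forall g, exists v, cyclic v (map_mx f (R g))) ->
  (forall g, exists x : K, (\rank (map_mx f (X g) - x%:M)%R <= m.+1 - r)%N) ->
  P *m Q = 1%:M ->
  (b -> forall i : 'I_m.+1, (i < m)%N -> (Q *m map_mx f B *m P) i i = 1) ->
  (b -> forall g k, \tr (B *m R g ^+ k) = 0) ->
  (b -> forall k, (0 < k <= m)%N -> k%:R != 0 :> K) ->
  (#|G| <= m.+1 ^ (r + b * m) *
    (2 * (m.+1 * m.+1) * (size S * m.+1)).+1 ^ (m.+1 * m.+1 + m.+2 - (r + b * m)))%N.
Proof.
move=> /andP[r0 rm] XS RS inj XR cyc rkX PQ Bdiag BR charK.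
have QP : Q *m P = 1%:M by apply: mulmx1C.
have /fin_all_exists[yux param] : forall g,
   exists t : ('I_r -> K) * ('I_(m.+1 - r) -> K) * K,
    (forall i, root (char_poly (map_mx f (R g))) (t.1.1 i)) /\
    map_mx f (X g) = t.2%:M + (\prod_i (map_mx f (R g) - (t.1.1 i)%:M)) *m
       (\sum_k t.1.2 k *: map_mx f (R g) ^+ k).
  move=> g; have [v cv] := cyc g; have [x rkx] := rkX g.
  have XRf : map_mx f (X g) *m map_mx f (R g) = map_mx f (R g) *m map_mx f (X g).
    by rewrite -!map_mxM XR.
  have [y [u [yP uP]]] := cyclic_param cv XRf rm rkx.
  by exists (y, u, x).
pose V : finType := ('I_m.+1 * 'I_m.+1 + ('I_r + option 'I_(m.+1 - r)))%type.
pose v (z : V) (g : G) : K := match z with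
  | inl ij => (Q *m map_mx f (R g) *m P) ij.1 ij.2
  | inr (inl i) => (yux g).1.1 i
  | inr (inr (Some k)) => (yux g).1.2 k
  | inr (inr None) => (yux g).2 end.
pose Zd (ij : 'I_m.+1 * 'I_m.+1) := [&& b, ij.1 == ij.2 & (ij.1 < m)%N].
pose Z (z : V) := match z with inl ij => Zd ij | inr (inl i) => true | inr (inr _) => false end.
(* An entry of R may involve diagonal entries of Q R P, which have weight 1; weight 2 for the
   eigenvalues makes the characteristic equation lower the weight. *)
pose w (z : V) : nat := match z with inl ij => Zd ij | inr (inl i) => 2 | inr (inr _) => 0 end.
have cO k : #|('I_k : finType)| = k by exact: card_ord.
have cardV : #|V| = (m.+1 * m.+1 + m.+2)%N.
  by rewrite /V !card_sum card_prod card_option !cO; lia.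
have cardZ : #|Z| = (r + b * m)%N.
  transitivity (\sum_(ij | Zd ij) 1 + (\sum_(i : 'I_r) 1 + 0))%N.
    rewrite -sum1_card big_sumType /= big_sumType /=.
    by rewrite [X in (_ + (_ + X))%N]big_pred0.
  rewrite [X in (_ + (X + _))%N]sum_nat_const cO muln1 addn0 addnC; congr (_ + _)%N.
  rewrite sum1_card /Zd; case: (b); last by rewrite mul0n eq_card0.
  rewrite mul1n -[RHS]cO.
  pose di (i : 'I_m) := (widen_ord (leqnSn m) i, widen_ord (leqnSn m) i).
  rewrite -(card_image (f := di)); last by move=> i j [] /val_inj.
  apply: eq_card => -[i j]; apply/idP/imageP => [/and3P[/= _ /eqP <- im]|[k _ ->]].
    by exists (Ordinal im) => //; congr (_, _); apply: val_inj.
  by rewrite unfold_in /= eqxx ltn_ord.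
pose I : finType := ('I_m.+1 * 'I_m.+1 + 'I_m.+1 * 'I_m.+1)%type.
(* At positions outside J the second block repeats an entry of X, which keeps every coordinate in
   S. *)
pose phi (i : I) (g : G) : K := match i with
  | inl ij => f (X g ij.1 ij.2)
  | inr ij => if ij \in J then f (R g ij.1 ij.2) else f (X g ij.1 ij.2) end.
have cardI : #|I| = (2 * (m.+1 * m.+1))%N by rewrite /I card_sum card_prod !cO mul2n addnn.
rewrite -cardZ -cardV -cardI -(size_map f S).
have RE g : map_mx f (R g) = P *m (Q *m map_mx f (R g) *m P) *m Q.
  by rewrite !mulmxA PQ mul1mx -mulmxA PQ mulmx1.
have w0_le D a h : wspan v (fun=> 0%N) a D h -> spanned v (fun m => deg m <= D)%N h.
  by apply: sub_spanned => k /andP[].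
have Rsp i j : wspan v w 1 1 (fun g => map_mx f (R g) i j).
  apply: (@eq_spanned _ _ _ _ _ (fun g =>
     \sum_k (\sum_l P i l * (Q *m map_mx f (R g) *m P) l k) * Q k j)).
    move=> g; rewrite [in RHS]RE [RHS]mxE; apply: eq_bigr => k _; congr (_ * _).
    by rewrite [RHS]mxE.
  apply: spanned_sum => k _; apply: (@eq_spanned _ _ _ _ _ (fun g =>
     Q k j * (\sum_l P i l * (Q *m map_mx f (R g) *m P) l k))); first by move=> g; rewrite mulrC.
  apply: spannedZ; apply: spanned_sum => l _; apply: spannedZ.
  by apply: wspan_le (wspan_var v w (inl (l, k) : V)); rewrite // /w; case: (Zd _).
have Rsp0 i j : wspan v (fun=> 0%N) 0 1 (fun g => map_mx f (R g) i j).
  by apply: sub_spanned (Rsp i j) => k /andP[h _]; rewrite /bounded h /wt big1.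
apply: (@card_grid_le K V G v w Z m.+1 m.+1 I phi (map f S)) => //.
- case=> [ij|[i|//]] //= Zij.
    have /and3P[bT /eqP ijE im] := Zij.
    have R'_wt (i j : 'I_m.+1) : wspan v w ((i == j) && (i < m)%N) 1
        (fun g => (Q *m map_mx f (R g) *m P) i j).
      by have := wspan_var v w (inl (i, j) : V); rewrite /w /Zd bT.
    have tr0 k g : \tr (Q *m map_mx f B *m P *m (Q *m map_mx f (R g) *m P) ^+ k) = 0.
      have -> : (Q *m map_mx f (R g) *m P) ^+ k = Q *m map_mx f (R g ^+ k) *m P.
        elim: k => [|k IH]; first by rewrite !expr0 map_mx1 mulmx1 QP.
        rewrite !exprS IH map_mxM -[LHS]/(_ *m _) !mulmxA -(mulmxA _ P Q) PQ mulmx1.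
        by rewrite -!mulmxA.
      rewrite !mulmxA -(mulmxA _ P Q) PQ mulmx1 mxtrace_mulC !mulmxA PQ mul1mx -map_mxM.
      by rewrite trace_map_mx BR // rmorph0.
    have H := @wspan_diag_exp K V G v w m (fun g => Q *m map_mx f (R g) *m P) R'_wt
      (Q *m map_mx f B *m P) (Bdiag bT) tr0 (charK bT) (Ordinal im).
    have {}H : wspan v w m.-1 m (fun g => v (inl ij) g ^+ m).
      apply: eq_spanned H => g; rewrite /v -ijE.
      by rewrite (_ : widen_ord _ _ = ij.1) //; apply: val_inj.
    have m0 : (0 < m)%N by apply: leq_ltn_trans im.
    (* The exponent is raised from m to m + 1 so that it agrees with the one for the eigenvalues. *)
    have H2 : wspan v w m m.+1 (fun g => v (inl ij) g ^+ m.+1).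
      apply: (@eq_spanned _ _ _ _ _ (fun g => v (inl ij) g * v (inl ij) g ^+ m)).
        by move=> g; rewrite exprS.
      apply: wspan_le (wspanM (wspan_var v w (inl ij : V)) H) => //.
      by rewrite /w Zij add1n prednK.
    by apply: sub_spanned H2 => k /andP[h1 h2]; rewrite h1 /= Zij muln1 ltnS.
  have H := @wspan_eigenvalue K V G v w m (fun g => v (inr (inl i)) g) (fun g => map_mx f (R g))
    (wspan_var v w (inr (inl i) : V)) Rsp.
  have {}H := H _; apply: sub_spanned (H _) => [k /andP[h1 h2]|g].
    by rewrite h1 /= mulnC; move: h2; rewrite -ltnS prednK // muln_gt0.
  have [yP _] := param g; have := yP i; rewrite -eigenvalue_root_char => /eigenvalueP[z zR z0].
  apply/eqP; apply: contraNT z0; rewrite -unitfE -unitmxE => Mu.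
  by apply/eqP/(can_inj (mulmxK Mu)); rewrite mul0mx mulmxBr mul_mx_scalar zR subrr.
- have Xdeg i j : wspan v (fun=> 0%N) 0 m.+1 (fun g => f (X g i j)).
    apply: (@eq_spanned _ _ _ _ _ (fun g => v (inr (inr None)) g *+ (i == j) +
      ((\prod_k (map_mx f (R g) - (v (inr (inl k)) g)%:M)) *m
       (\sum_k v (inr (inr (Some k))) g *: map_mx f (R g) ^+ k)) i j)).
      move=> g; have [_ XE] := param g; have := congr1 (fun M : 'M_m.+1 => M i j) XE.
      by rewrite !mxE => ->; congr (_ + _).
    have x0 z : wspan v (fun=> 0%N) 0 1 (v z) by exact: (wspan_var v (fun=> 0%N)).
    apply: spannedD.
      case: (i == j); last exact: spanned0.
      by apply: wspan_le (x0 (inr (inr None))).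
    apply: (@wspan_le _ _ _ _ _ (r * 0 + 0)%N _ (r * 1 + (m.+1 - r))%N).
    - by rewrite muln0.
    - by rewrite muln1 subnKC.
    apply: wspan_mulmx => {i j} i j.
      apply: wspan_prodmx => k {i j} i j.
      apply: (@eq_spanned _ _ _ _ _ (fun g => map_mx f (R g) i j - v (inr (inl k)) g *+ (i == j))).
        by move=> g; rewrite !mxE.
      apply: spannedB; first exact: Rsp0.
      by case: (i == j); [exact: x0|exact: spanned0].
    apply: (@eq_spanned _ _ _ _ _ (fun g =>
       \sum_k v (inr (inr (Some k))) g * (map_mx f (R g) ^+ k) i j)).
      by move=> g; rewrite summxE; apply: eq_bigr => k _; rewrite mxE.
    apply: spanned_sum => k _.
    by apply: wspan_le (wspanM (x0 (inr (inr (Some k)))) (wspan_expmx Rsp0 k i j)); rewrite ?muln0 ?muln1.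
  move=> i; apply: (w0_le _ 0%N); case: i => [ij|ij] /=; first exact: Xdeg.
  rewrite /phi; case: (ij \in J); last exact: Xdeg.
  by apply: (@eq_spanned _ _ _ _ _ (fun g => map_mx f (R g) ij.1 ij.2)) => [g|];
    [rewrite mxE|exact: wspan_le (Rsp0 _ _)].
- case=> [ij|ij] g /=; first by rewrite map_f.
  by case: ifP => ijJ; rewrite map_f // RS.
move=> g g' e; have XX : X g = X g'.
  by apply/matrixP => i j; apply: (fmorph_inj f); exact: (e (inl (i, j))).
apply: inj => // ij ijJ; apply: (fmorph_inj f).
by have := e (inr ij); rewrite /phi ijJ.
Qed.

End Pairs.

Lemma leq_expW p q e : (p <= q)%N -> (p ^ e <= q ^ e)%N.
Proof. by case: e => // e; rewrite leq_exp2r. Qed.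

(** * Summing the sizes of centralizers *)

Section Strata.
Variables (F : finFieldType) (K : closedFieldType) (f : {rmorphism F -> K}).
Variables (m : nat) (S : seq F) (b : bool) (P Q : 'M[K]_m.+1) (B : 'M[F]_m.+1).
Hypothesis PQ : P *m Q = 1%:M.
Hypothesis Bdiag : b -> forall i : 'I_m.+1, (i < m)%N -> (Q *m map_mx f B *m P) i i = 1.
Hypothesis charK : b -> forall k, (0 < k <= m)%N -> k%:R != 0 :> K.
Hypothesis uS : uniq S.
Local Notation n := m.+1.

Definition cent_card (X : 'M[F]_n) := #|[set Y : 'M[F]_n | X *m Y == Y *m X]|.

Lemma cent_card_le X : (cent_card X <= #|F| ^ \rank 'C(mxvec X)%MS)%N.
Proof.
have [iota [psi [_ psiE _]]] := row_coordinates 'C(mxvec X)%MS.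
rewrite -[\rank _]mul1n -card_mx -cardsT.
apply: leq_trans (leq_imset_card (fun u => vec_mx (u *m psi)) _).
apply: subset_leq_card; apply/subsetP => Y; rewrite inE => /eqP /cent1P.
rewrite (_ : (mxvec Y <= 'C(mxvec X))%MS = (mxvec Y <= psi)%MS); last by rewrite psiE.
move=> /submxP[u uE]; apply/imsetP; exists u; rewrite ?inE //.
by rewrite -uE mxvecK.
Qed.

Definition orth_cent (X : 'M[F]_n) :=
  [forall i, forall j, X i j \in S] &&
  (b ==> [forall Y : 'M[F]_n, (X *m Y == Y *m X) ==> (\tr (B *m Y) == 0)]).

(** G consists of the pairs (X, R) with R in [L X]. Each X has at least (|S| - n^2)^d partners, and
    [card_pairs_le] bounds the pairs. *)
Lemma card_stratum r d (J : {set 'I_n * 'I_n}) (XX : {set 'M[F]_n})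
    (L : 'M[F]_n -> seq 'M[F]_n) : (0 < r <= n)%N ->
  (forall X, X \in XX -> orth_cent X) ->
  (forall X, X \in XX -> exists x : K, (\rank (map_mx f X - x%:M)%R <= n - r)%N) ->
  (forall X, X \in XX -> [/\ uniq (L X), ((size S - n * n) ^ d <= size (L X))%N,
      (forall R, R \in L X -> [/\ X *m R = R *m X, forall ij, ij \in J -> R ij.1 ij.2 \in S &
        exists v, cyclic v (map_mx f R)]) &
      (forall R R', R \in L X -> R' \in L X -> (forall ij, ij \in J -> R ij.1 ij.2 = R' ij.1 ij.2) ->
        R = R')]) ->
  (#|XX| * (size S - n * n) ^ d <= n ^ (r + b * m) *
    (2 * (n * n) * (size S * n)).+1 ^ (n * n + n.+1 - (r + b * m)))%N.
Proof.
move=> rn XXorth XXrk XXL.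
pose G := {XR : 'M[F]_n * 'M[F]_n | (XR.1 \in XX) && (XR.2 \in L XR.1)}.
have GP (g : G) := andP (valP g).
apply: (@leq_trans #|{: G}|).
  rewrite card_sig -[X in (_ <= X)%N]sum1_card (eq_bigl (fun XR => (XR.1 \in XX) && (XR.2 \in L XR.1))) //.
  rewrite -(pair_big_dep (mem XX) (fun X R => R \in L X) (fun _ _ => 1%N)) /=.
  rewrite -sum_nat_const leq_sum // => X XXX.
  by have [uL sL _ _] := XXL X XXX; rewrite sum1_card (card_uniqP uL).
apply: (@card_pairs_le F K f m r S J b P Q B G (fun g => (val g).1) (fun g => (val g).2)) => //.
- move=> g i j; have [gX _] := GP g.
  by have /andP[/forallP/(_ i)/forallP/(_ j)] := XXorth _ gX.
- move=> g ij ijJ; have [gX gR] := GP g.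
  by have [_ _ h _] := XXL _ gX; have [_ h2 _] := h _ gR; exact: h2.
- move=> g g' e1 e2; have [gX gR] := GP g; have [gX' gR'] := GP g'.
  apply: val_inj; rewrite [val g]surjective_pairing [val g']surjective_pairing.
  rewrite e1; congr (_, _); have [_ _ _ h] := XXL _ gX.
  by apply: h => //; rewrite e1.
- by move=> g; have [gX gR] := GP g; have [_ _ h _] := XXL _ gX; have [] := h _ gR.
- by move=> g; have [gX gR] := GP g; have [_ _ h _] := XXL _ gX; have [] := h _ gR.
- by move=> g; have [gX gR] := GP g; exact: XXrk.
move=> bT g k; have [gX gR] := GP g.
have /andP[_] := XXorth _ gX; rewrite bT => /forallP /(_ ((val g).2 ^+ k)) /implyP h.
apply/eqP/h/eqP; have [_ _ h1 _] := XXL _ gX; have [XR _ _] := h1 _ gR.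
exact: (@commrX _ (val g).1 (val g).2 k XR).
Qed.

Variables (A H : nat).
Hypothesis A0 : (0 < A)%N.
Hypothesis H0 : (0 < H)%N.
Hypothesis S_large : (2 * (n * n) <= size S)%N.
Hypothesis F_le : (#|F| <= A * (H * size S))%N.
Hypothesis H_le : (H ^ n.+1 <= size S)%N.

Definition stratum_const :=
  ((A * 2) ^ (n * n) * (n ^ (2 * n) * (2 * (n * n) * n).+1 ^ (n * n + n.+1)))%N.

(** Replacing (|S| - n^2)^d by |F|^d costs a constant times H^d. As d <= n r and H^n <= s for s =
    |S|, this is at most H^n s^(r-1), which makes up for the r in the exponent of the pair count. *)
Lemma stratum_arith r d k : (0 < r <= n)%N -> (d <= n * n)%N -> (d <= n * r)%N ->
  (k * (size S - n * n) ^ d <= n ^ (r + b * m) *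
    (2 * (n * n) * (size S * n)).+1 ^ (n * n + n.+1 - (r + b * m)))%N ->
  (k * #|F| ^ d <= stratum_const * (H ^ n * size S ^ (n * n + n - b * m)))%N.
Proof.
move=> /andP[r0 rn] dnn dnr; set s := size S; set e := (n * n + n.+1 - (r + b * m))%N => kd.
have s0 : (0 < s)%N by apply: leq_trans S_large; rewrite !muln_gt0.
have bm : (b * m <= m)%N by case: (b); rewrite ?mul1n ?mul0n.
have s2 : (s <= 2 * (s - n * n))%N.
  by move: S_large; rewrite -/s; move: (n * n)%N => x; lia.
have h1 : (#|F| ^ d <= A ^ d * (H ^ d * (2 ^ d * (s - n * n) ^ d)))%N.
  rewrite -!expnMn leq_expW // (leq_trans F_le) // leq_mul2l leq_mul2l s2 !orbT //.
have h2 : (H ^ d <= H ^ n * s ^ r.-1)%N.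
  apply: (@leq_trans (H ^ (n * r))); first by rewrite leq_pexp2l.
  rewrite -{1}(prednK r0) mulnS expnD leq_mul2l expnM leq_expW ?orbT //.
  by apply: leq_trans H_le; rewrite leq_pexp2l.
have h3 : ((2 * (n * n) * (s * n)).+1 ^ e <= (2 * (n * n) * n).+1 ^ (n * n + n.+1) * s ^ e)%N.
  apply: (@leq_trans (((2 * (n * n) * n).+1 * s) ^ e)).
    rewrite leq_expW // mulSn -addn1 addnC leq_add //.
    by rewrite (mulnC s) mulnA.
  by rewrite expnMn leq_mul2r leq_pexp2l ?orbT // leq_subr.
have h4 : (n ^ (r + b * m) <= n ^ (2 * n))%N.
  by rewrite leq_pexp2l // mul2n -addnn leq_add // (leq_trans bm).
have h5 : ((A * 2) ^ d <= (A * 2) ^ (n * n))%N by rewrite leq_pexp2l // muln_gt0 A0.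
have eE : (e + r.-1 = n * n + n - b * m)%N.
  have := leq_pmulr n (ltn0Sn m); rewrite /e; move: r0 rn bm.
  by move: (b * m)%N (n * n)%N; clear => x y; lia.
have -> : (s ^ (n * n + n - b * m) = s ^ e * s ^ r.-1)%N by rewrite -eE expnD.
apply: (@leq_trans ((A * 2) ^ d * (H ^ d * (n ^ (r + b * m) * (2 * (n * n) * (s * n)).+1 ^ e)))).
  apply: (@leq_trans (k * (A ^ d * (H ^ d * (2 ^ d * (s - n * n) ^ d))))).
    by rewrite leq_mul2l h1 orbT.
  rewrite (_ : (k * _ = (A * 2) ^ d * (H ^ d * (k * (s - n * n) ^ d)))%N).
    by rewrite leq_mul2l leq_mul2l kd !orbT.
  by rewrite expnMn; move: (A ^ d)%N (H ^ d)%N (2 ^ d)%N ((s - n * n) ^ d)%N; clear => *; ring.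
apply: (@leq_trans ((A * 2) ^ (n * n) * ((H ^ n * s ^ r.-1) * (n ^ (2 * n) *
   ((2 * (n * n) * n).+1 ^ (n * n + n.+1) * s ^ e))))).
  by do 3!apply: leq_mul => //.
rewrite /stratum_const.
move: ((A * 2) ^ (n * n))%N (H ^ n)%N (s ^ r.-1)%N (n ^ (2 * n))%N (s ^ e)%N
  ((2 * (n * n) * n).+1 ^ (n * n + n.+1))%N; clear => x1 x2 x3 x4 x5 x6.
by rewrite leq_eqVlt; apply/orP; left; apply/eqP; ring.
Qed.

Lemma sum_cent_card :
  (\sum_(X | orth_cent X) cent_card X <=
    (n.+1 * (n * n).+1 * 2 ^ (n * n) * stratum_const) * (H ^ n * size S ^ (n * n + n - b * m)))%N.
Proof.
have /fin_all_exists[t tP] : forall X : 'M[F]_n,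
    exists t : nat * {set 'I_n * 'I_n} * seq 'M[F]_n,
  ([/\ (0 < t.1.1 <= n)%N, exists x : K, (\rank (map_mx f X - x%:M)%R <= n - t.1.1)%N &
    (\rank 'C(mxvec X)%MS <= n * t.1.1)%N]) /\
  [/\ uniq t.2, ((size S - n * n) ^ \rank 'C(mxvec X)%MS <= size t.2)%N,
      (forall R, R \in t.2 -> [/\ X *m R = R *m X, forall ij, ij \in t.1.2 -> R ij.1 ij.2 \in S &
        exists v, cyclic v (map_mx f R)]) &
      (forall R R', R \in t.2 -> R' \in t.2 ->
        (forall ij, ij \in t.1.2 -> R ij.1 ij.2 = R' ij.1 ij.2) -> R = R')].
  move=> X; have [r rP] := exists_max_nullity f X.
  by have [J [L [uL sL _ LP Linj]]] := cyclic_grid f X uS; exists (r, J, L).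
(* X is classified by r, the dimension d of its centralizer and J. The number of classes depends
   only on n, and [inord] loses nothing since r <= n and d <= n^2. *)
pose key (X : 'M[F]_n) : 'I_n.+1 * 'I_(n * n).+1 * {set 'I_n * 'I_n} :=
  (inord (t X).1.1, inord (\rank 'C(mxvec X)%MS), (t X).1.2).
rewrite (partition_big key xpredT) //=.
pose bound := (stratum_const * (H ^ n * size S ^ (n * n + n - b * m)))%N.
apply: (@leq_trans (\sum_(c : 'I_n.+1 * 'I_(n * n).+1 * {set 'I_n * 'I_n}) bound)); last first.
  have cS : #|{: {set 'I_n * 'I_n}}| = (2 ^ (n * n))%N.
    by rewrite -cardsT -powersetT card_powerset cardsT card_prod !card_ord.
  by rewrite sum_nat_const card_prod card_prod cS !card_ord -[X in (_ <= X)%N]mulnA.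
apply: leq_sum => -[[r d] J] _.
pose XX := [set X | orth_cent X && (key X == (r, d, J))].
have XXP X : X \in XX -> [/\ orth_cent X, (t X).1.1 = r, \rank 'C(mxvec X)%MS = d & (t X).1.2 = J].
  rewrite inE => /andP[oX /eqP[rE dE JE]]; split=> //.
    by rewrite -rE inordK //; have [[/andP[_ h] _ _] _] := tP X.
  by rewrite -dE inordK // ltnS rank_leq_row.
have [XX0|[X0 X0P]] := set_0Vmem XX.
  rewrite big_pred0 // => X; apply/negP => h.
  have : X \in XX by rewrite inE.
  by rewrite XX0 inE.
apply: (@leq_trans (#|XX| * #|F| ^ d)).
  rewrite -sum_nat_const [X in (X <= _)%N](eq_bigl (fun X => X \in XX)) => [|X]; last by rewrite inE.
  apply: leq_sum => X XXX; have [_ _ dE _] := XXP X XXX.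
  by rewrite -dE; exact: cent_card_le.
have [_ rE dE JE] := XXP X0 X0P; have [[r0 _ dr] _] := tP X0.
have rn : (0 < r <= n)%N by rewrite -rE.
apply: (stratum_arith (r := r)) => //; first by rewrite -ltnS.
  by rewrite -dE -rE.
apply: (@card_stratum r d J XX (fun X => (t X).2)) => // X XXX.
- by have [] := XXP X XXX.
- by have [_ <- _ _] := XXP X XXX; have [[_ h _] _] := tP X.
- by have [_ _ <- <-] := XXP X XXX; have [_ h] := tP X.
Qed.

End Strata.

(** * Points of a subgroup in a box *)

Section Fourier.
(** [ec] and [es] stand for the cosine and sine of 2 pi x / p, that is, for an additive character in
    real form. *)
Variables (R : realFieldType) (p : nat) (ec es : 'F_p -> R).
Hypothesis ec0 : ec 0 = 1.
Hypothesis es0 : es 0 = 0.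
Hypothesis ecB : forall x y, ec (x - y) = ec x * ec y + es x * es y.
Hypothesis esB : forall x y, es (x - y) = es x * ec y - ec x * es y.
Hypothesis ec_lt1 : forall x, x != 0 -> ec x < 1.
Hypothesis ec_small : forall k, (8 * k <= p)%N -> 2^-1 <= ec k%:R.

Lemma ecN x : ec (- x) = ec x.
Proof. by rewrite -sub0r ecB ec0 es0 mul1r mul0r addr0. Qed.

Variables (n : nat) (L : {set 'M['F_p]_n}).
Hypothesis L0 : 0 \in L.
Hypothesis LB : forall Y Z, Y \in L -> Z \in L -> Y - Z \in L.

(* Translating by a Z0 with tr(c Z0) <> 0 rotates the pair of sums of [ec] and [es], which must
   therefore vanish. *)
Lemma sum_ec_orth (c : 'M['F_p]_n) :
  \sum_(Z in L) ec (\tr (c *m Z)) =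
  if [forall (Z | Z \in L), \tr (c *m Z) == 0] then #|L|%:R else 0.
Proof.
case: ifP => [/forall_inP h|/negbT].
  by rewrite (eq_bigr (fun=> 1)) ?sumr_const // => Z /h/eqP ->.
rewrite negb_forall_in => /exists_inP[Z0 Z0L x0].
set x := \tr (c *m Z0) in x0.
set C := LHS; pose S := \sum_(Z in L) es (\tr (c *m Z)).
have shift (e : 'F_p -> R) : \sum_(Z in L) e (\tr (c *m Z)) = \sum_(Z in L) e (\tr (c *m Z) - x).
  rewrite (reindex_onto (fun Z => Z - Z0) (fun Z => Z + Z0)) /=; last by move=> Z _; rewrite addrK.
  apply: eq_big => [Z|Z _]; last by rewrite mulmxBr linearB.
  rewrite subrK eqxx andbT; apply/idP/idP => [h|]; last by move=> h; exact: LB.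
  rewrite -[Z](subrK Z0) -[Z0]opprK -[X in _ - X]sub0r; apply: LB; first by rewrite opprK.
  exact: LB.
have CE : C = ec x * C + es x * S.
  rewrite {1}/C shift /S !mulr_sumr -big_split /=; apply: eq_bigr => Z _.
  by rewrite ecB; ring.
have SE : S = ec x * S - es x * C.
  rewrite {1}/S shift /C !mulr_sumr -sumrB /=; apply: eq_bigr => Z _.
  by rewrite esB; ring.
have ex := ec_lt1 x0.
have : ((1 - ec x) ^+ 2 + es x ^+ 2) * C = 0.
  have h1 : (1 - ec x) * C = es x * S by rewrite mulrBl mul1r {1}CE addrAC subrr add0r.
  have h2 : (1 - ec x) * S = - (es x * C) by rewrite mulrBl mul1r {1}SE addrAC subrr add0r.
  rewrite mulrDl expr2 -mulrA h1 mulrCA h2; ring.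
move/eqP; rewrite mulf_eq0 => /orP[|/eqP //].
rewrite paddr_eq0 ?sqr_ge0 // sqrf_eq0 subr_eq0 => /andP[/eqP h _].
by rewrite -h ltxx in ex.
Qed.

Variables (t H : nat).
Hypothesis p_large : (8 * (n * n * (H * t)) <= p)%N.

Definition box_mx (Y : 'M['I_t.*2.+1]_n) : 'M['F_p]_n := \matrix_(i, j) ((Y i j)%:R - t%:R).
(** The entries are differences of two integers in [0, H), stored with a shift by H. *)
Definition diff_mx (c : 'M['I_H.*2]_n) : 'M['F_p]_n := \matrix_(i, j) ((c i j)%:R - H%:R).
Definition freq_mx (a : 'M['I_H]_n) : 'M['F_p]_n := \matrix_(i, j) (a i j)%:R.

(** The trace is the residue of an integer u - w of absolute value at most n^2 H t <= p / 8, so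
    [ec_small] applies up to sign. *)
Lemma ec_box a Y : 2^-1 <= ec (\tr (freq_mx a *m box_mx Y)).
Proof.
pose u := (\sum_i \sum_j a i j * Y j i)%N; pose w := (\sum_i \sum_j a i j * t)%N.
have -> : \tr (freq_mx a *m box_mx Y) = u%:R - w%:R.
  rewrite /mxtrace /u /w !natr_sum -sumrB; apply: eq_bigr => i _.
  rewrite mxE !natr_sum -sumrB; apply: eq_bigr => j _.
  by rewrite !mxE !natrM mulrBr.
have bound : (\sum_(i < n) \sum_(j < n) H * t = n * n * (H * t))%N.
  by rewrite !sum_nat_const !card_ord mulnA.
have uw : (u <= w + n * n * (H * t))%N.
  rewrite -bound -big_split leq_sum // => i _ /=.
  rewrite -big_split leq_sum // => j _ /=.
  apply: (@leq_trans (a i j * t + a i j * t)).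
    by rewrite -mulnDr leq_mul2l addnn -ltnS ltn_ord orbT.
  by rewrite leq_add2l leq_mul2r ltnW ?orbT.
have wu : (w <= u + n * n * (H * t))%N.
  rewrite -bound -big_split leq_sum // => i _ /=.
  rewrite -big_split leq_sum // => j _ /=.
  by apply: leq_trans (leq_addl _ _); rewrite leq_mul2r ltnW ?orbT.
have [le|/ltnW le] := leqP w u.
  by rewrite -natrB //; apply: ec_small; apply: leq_trans p_large; rewrite leq_mul2l leq_subLR.
rewrite -opprB ecN -natrB //; apply: ec_small; apply: leq_trans p_large.
by rewrite leq_mul2l leq_subLR.
Qed.

Hypothesis H0 : (0 < H)%N.
Hypothesis p_prime : prime p.
Hypothesis t_small : (t.*2 < p)%N.

Lemma box_mx_inj : injective box_mx.
Proof.
move=> Y Y' e; apply/matrixP => i j; apply: val_inj.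
have := congr1 (fun M : 'M_n => M i j) e; rewrite !mxE => /addIr /(congr1 val).
by rewrite /= !val_Fp_nat // !modn_small //; apply: leq_ltn_trans t_small; rewrite -ltnS.
Qed.

(* Both inequalities bound the sum over Z in L of the squared modulus of the sum over a of
   e(tr(a Z) / p), where a has entries in [0, H). *)
Lemma card_box_le :
  (#|[set Y | box_mx Y \in L]| * H ^ (n * n) <=
    4 * (#|L| * #|[set c | [forall (Z | Z \in L), \tr (diff_mx c *m Z) == 0%R]]|))%N.
Proof.
set BL := [set Y | _]; set CL := [set c | _].
pose A := 'M['I_H]_n.
have cardA : #|{: A}| = (H ^ (n * n))%N by rewrite card_mx card_ord.
rewrite -cardA.
pose g Z := (\sum_(a : A) ec (\tr (freq_mx a *m Z))) ^+ 2 +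
            (\sum_(a : A) es (\tr (freq_mx a *m Z))) ^+ 2.
have g_ge0 Z : 0 <= g Z by rewrite addr_ge0 ?sqr_ge0.
(* Each point of the box in L contributes at least the square of half the number of frequencies, by
   [ec_box]. *)
have lower : #|BL|%:R * (#|{: A}|%:R / 2) ^+ 2 <= \sum_(Z in L) g Z.
  apply: (@le_trans _ _ (\sum_(Z in box_mx @: BL) g Z)).
    rewrite big_imset /=; last by move=> ? ? _ _; exact: box_mx_inj.
    rewrite mulr_natl -sumr_const; apply: ler_sum => Y _.
    apply: (@le_trans _ _ ((\sum_(a : A) ec (\tr (freq_mx a *m box_mx Y))) ^+ 2)); last first.
      by rewrite lerDl sqr_ge0.
    rewrite ler_sqr ?nnegrE ?divr_ge0 //.
      rewrite mulrC mulr_natr -sumr_const; apply: ler_sum => a _; exact: ec_box.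
    apply: sumr_ge0 => a _; apply: le_trans (ec_box a Y); by rewrite invr_ge0.
  have sub : box_mx @: BL \subset L by apply/subsetP => _ /imsetP[Y + ->]; rewrite inE.
  rewrite [X in _ <= X](big_setID (box_mx @: BL)) /= (setIidPr sub) lerDl.
  by apply: sumr_ge0.
have upper : \sum_(Z in L) g Z <= (#|L| * (#|{: A}| * #|CL|))%:R.
  (* Expanding the squares gives sums of [ec] at differences of frequencies, to which orthogonality
     applies. *)
  have -> : \sum_(Z in L) g Z = \sum_(aa : A * A)
      \sum_(Z in L) ec (\tr ((freq_mx aa.1 - freq_mx aa.2) *m Z)).
    rewrite exchange_big /=; apply: eq_bigr => Z _.
    rewrite -(pair_big xpredT xpredT (fun a a' => ec (\tr ((freq_mx a - freq_mx a') *m Z)))) /=.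
    rewrite /g !expr2 !mulr_suml -big_split /=; apply: eq_bigr => a _.
    rewrite !mulr_sumr -big_split /=; apply: eq_bigr => a' _.
    by rewrite mulmxBl linearB /= ecB.
  under eq_bigr do rewrite sum_ec_orth.
  rewrite -big_mkcond sumr_const -mulrnA ler_nat leq_mul2l.
  apply/orP; right.
  have d_lt (a a' : A) i j : (a i j + H - a' i j < H.*2)%N.
    by have := ltn_ord (a i j); rewrite -addnn; lia.
  (* A pair of frequencies is determined by the first one and the difference, so at most |A| |CL|
     pairs survive. *)
  pose d (aa : A * A) : A * 'M['I_H.*2]_n :=
    (aa.1, \matrix_(i, j) Ordinal (d_lt aa.1 aa.2 i j)).
  have d_inj : injective d.
    move=> [a a'] [b b'] [<- /matrixP e]; congr (_, _); apply/matrixP => i j; apply: val_inj.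
    have := e i j; rewrite !mxE => /(congr1 val) /=.
    have := ltn_ord (a' i j); have := ltn_ord (b' i j); lia.
  rewrite -(card_imset _ d_inj) -[#|{: A}|]cardsT -cardsX subset_leq_card //.
  apply/subsetP => _ /imsetP[[a a'] + ->]; rewrite !inE /= => h.
  have -> // : diff_mx (\matrix_(i, j) Ordinal (d_lt a a' i j)) = freq_mx a - freq_mx a'.
  apply/matrixP => i j; rewrite !mxE /= natrB ?natrD; first by ring.
  by rewrite (leq_trans (ltnW (ltn_ord _))) // leq_addl.
have := le_trans lower upper; rewrite natrM => h.
rewrite -(ler_nat R) !natrM.
have A0 : 0 < #|{: A}|%:R :> R by rewrite ltr0n cardA expn_gt0 H0.
rewrite -(ler_pM2r A0) -(ler_pM2r (_ : 0 < 4^-1)) ?invr_gt0 //.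
move: h; rewrite !natrM; set x := _%:R; set y := #|_|%:R; set z := #|_|%:R; set q := #|_|%:R.
lra.
Qed.

End Fourier.

(** * Reduction modulo p *)

(* The box of matrices with entries in [-t, t] is indexed by matrices over 'I_t.*2.+1. *)
Definition int_box_mx n t (Y : 'M['I_t.*2.+1]_n) : 'M[int]_n :=
  \matrix_(i, j) ((Y i j)%:Z - t%:Z).

Definition pair_count n t :=
  #|[set XY : 'M['I_t.*2.+1]_n * 'M['I_t.*2.+1]_n |
     int_box_mx XY.1 *m int_box_mx XY.2 == int_box_mx XY.2 *m int_box_mx XY.1]|.

Section ModP.
Variables (p m : nat).
Hypothesis p_prime : prime p.
Local Notation n := m.+1.
Hypothesis n_lt_p : (n < p)%N.

Lemma natr_Fp_neq0 k : (0 < k < p)%N -> k%:R != 0 :> 'F_p.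
Proof.
move=> /andP[k0 kp]; apply/eqP => /(congr1 val); rewrite /= val_Fp_nat //.
by rewrite modn_small // => k00; rewrite k00 in k0.
Qed.

(** A scalar matrix b has trace n b, and n is invertible modulo p. *)
Lemma trace0_nonscalar (B : 'M['F_p]_n) : \tr B = 0 -> B != 0 -> ~~ is_scalar_mx B.
Proof.
move=> trB; apply: contraNN => /is_scalar_mxP[b BE].
move: trB; rewrite BE mxtrace_scalar -mulr_natr => /eqP; rewrite mulf_eq0.
by rewrite (negPf (natr_Fp_neq0 _)) ?n_lt_p // orbF => /eqP ->; rewrite raddf0.
Qed.

Variables (S : seq 'F_p) (A H : nat).
Hypothesis uS : uniq S.
Hypothesis A0 : (0 < A)%N.
Hypothesis H0 : (0 < H)%N.
Hypothesis S_large : (2 * (n * n) <= size S)%N.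
Hypothesis F_le : (p <= A * (H * size S))%N.
Hypothesis H_le : (H ^ n.+1 <= size S)%N.

Definition sum_const := (n.+1 * (n * n).+1 * 2 ^ (n * n) * stratum_const m A)%N.

(** The stratum bounds are applied over an algebraic closure of 'F_p. For nonzero B the trace
    condition makes B nonscalar, so its diagonal can be prescribed. *)
Lemma sum_cent_card_Fp (B : 'M['F_p]_n) : \tr B = 0 ->
  (\sum_(X : 'M['F_p]_n | [forall i, forall j, X i j \in S] &&
      [forall (Z | Z \in [set Y | X *m Y == Y *m X]%R), \tr (B *m Z)%R == 0%R]) cent_card X <=
    sum_const * (H ^ n * size S ^ (n * n + n - (B != 0%R) * m)))%N.
Proof.
move=> trB; have [K [f _]] := countable_algebraic_closure 'F_p.
pose b := B != 0.
have [P [Q [PQ Bdiag]]] : exists P Q : 'M[K]_n, P *m Q = 1%:M /\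
    (b -> forall i : 'I_n, (i < m)%N -> (Q *m map_mx f B *m P) i i = 1).
  have [B0|B0] := boolP b; last first.
    by exists 1%:M, 1%:M; rewrite mulmx1.
  have nsB : ~~ is_scalar_mx (map_mx f B).
    apply: contraNN (trace0_nonscalar trB B0) => /is_scalar_mxP[a aE].
    apply/is_scalar_mxP; exists (B 0 0); apply/matrixP => i j; rewrite mxE.
    have E k l : f (B k l) = a *+ (k == l).
      by have := congr1 (fun M : 'M_n => M k l) aE; rewrite !mxE.
    apply: (fmorph_inj f); rewrite E; case: (i == j); rewrite ?rmorph0 //.
    by rewrite !mulr1n E eqxx.
  (* The last entry is 1 - n = - m, which makes the trace zero. *)
  pose d (i : 'I_n) : K := if (i < m)%N then 1 else - m%:R.
  have sd : \sum_i d i = \tr (map_mx f B).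
    rewrite trace_map_mx trB rmorph0 big_ord_recr /= /d /= ltnn.
    rewrite (eq_bigr (fun=> 1)) => [|i _]; last by rewrite /= ltn_ord.
    by rewrite sumr_const card_ord subrr.
  have [D [P [Q [PQ DE]]] Dd] := similar_diag nsB sd.
  exists P, Q; split=> // _ i im; rewrite -DE Dd /d im //.
have charK : b -> forall k, (0 < k <= m)%N -> k%:R != 0 :> K.
  move=> _ k /andP[k0 km]; rewrite -(rmorph_nat f) fmorph_eq0 natr_Fp_neq0 // k0.
  by apply: leq_ltn_trans km (ltn_trans _ n_lt_p).
have F_le' : (#|{: 'F_p}| <= A * (H * size S))%N by rewrite card_Fp.
have := @sum_cent_card _ K f m S b P Q B PQ Bdiag charK uS A H A0 H0 S_large F_le' H_le.
apply: leq_trans; rewrite /orth_cent -/b.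
rewrite [X in (_ <= X)%N](bigID (fun X =>
  [forall (Z | Z \in [set Y | X *m Y == Y *m X]), \tr (B *m Z) == 0])) /=.
apply: leq_trans (leq_addr _ _); rewrite leq_eqVlt; apply/orP; left; apply/eqP.
apply: eq_bigl => X; case: [forall i, _] => //=.
rewrite andb_idl // => /forall_inP h; apply/implyP => _; apply/forallP => Y.
by apply/implyP => XY; apply: h; rewrite inE.
Qed.

End ModP.

(** * Counting commuting pairs in the box *)

Section Count.
Variables (R : realFieldType) (p : nat) (ec es : 'F_p -> R).
Hypothesis ec0 : ec 0 = 1.
Hypothesis es0 : es 0 = 0.
Hypothesis ecB : forall x y, ec (x - y) = ec x * ec y + es x * es y.
Hypothesis esB : forall x y, es (x - y) = es x * ec y - ec x * es y.
Hypothesis ec_lt1 : forall x, x != 0 -> ec x < 1.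
Hypothesis ec_small : forall k, (8 * k <= p)%N -> 2^-1 <= ec k%:R.

Variables (m t A H : nat).
Local Notation n := m.+1.
Hypothesis p_prime : prime p.
Hypothesis H0 : (0 < H)%N.
Hypothesis A0 : (0 < A)%N.
Hypothesis t_large : (n * n <= t)%N.
Hypothesis p_large : (8 * (n * n * (H * t)) < p)%N.
Hypothesis p_le : (p <= A * (H * t))%N.
Hypothesis H_le : (H ^ n.+1 <= t)%N.

Lemma reduce_box (Y : 'M['I_t.*2.+1]_n) : map_mx intr (int_box_mx Y) = box_mx p Y :> 'M['F_p]_n.
Proof. by apply/matrixP => i j; rewrite !mxE rmorphB. Qed.

Lemma H2_lt_p : (H.*2 < p)%N.
Proof.
have t0 : (0 < t)%N by apply: leq_trans t_large.
apply: leq_ltn_trans p_large; rewrite -muln2 mulnC leq_mul //.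
by rewrite mulnCA leq_pmulr // muln_gt0 t0 andbT.
Qed.

Lemma diff_entry_inj (k l : 'I_H.*2) : (k%:R - H%:R : 'F_p) = l%:R - H%:R -> k = l.
Proof.
move=> /addIr /(congr1 val); rewrite /= !val_Fp_nat // !modn_small ?(ltn_trans _ H2_lt_p) //.
exact: val_inj.
Qed.

Lemma diff_mx_inj : injective (@diff_mx p n H).
Proof.
move=> c c' e; apply/matrixP => i j; apply: diff_entry_inj.
by have := congr1 (fun M : 'M_n => M i j) e; rewrite !mxE.
Qed.

(** The trace condition recovers the corner entry from all the others. *)
Lemma card_trace0 :
  (#|[set c : 'M['I_H.*2]_n | \tr (diff_mx p c) == 0%R]| <= H.*2 ^ (n * n).-1)%N.
Proof.
pose T := {ij : 'I_n * 'I_n | ij != (0, 0)}.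
have cardT : #|{: T}| = (n * n).-1 by rewrite card_sig cardC1 card_prod !card_ord.
rewrite -cardT -[X in (X ^ _)%N]card_ord -card_ffun.
pose r (c : 'M['I_H.*2]_n) : {ffun T -> 'I_H.*2} := [ffun ij => c (val ij).1 (val ij).2].
rewrite -(card_in_imset (f := r)); first exact: max_card.
move=> c c'; rewrite !inE => /eqP trc /eqP trc' /ffunP e.
have E i j : (i, j) != (0, 0) -> c i j = c' i j.
  by move=> h; have := e (Sub (i, j) h); rewrite !ffunE.
suff c00 : c 0 0 = c' 0 0.
  by apply/matrixP => i j; have [[-> ->] //|h] := eqVneq (i, j) (0, 0); exact: E.
apply: diff_entry_inj; move: trc; rewrite -trc' /mxtrace (bigD1 0) // [RHS](bigD1 0) //=.
rewrite (eq_bigr (fun i => diff_mx p c' i i)); last first.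
  by move=> i i0; rewrite !mxE E // xpair_eqE (negPf i0).
by move=> /addIr; rewrite !mxE.
Qed.

Local Notation L X := [set Y : 'M['F_p]_n | X *m Y == Y *m X].
Local Notation orth c X := [forall (Z | Z \in L X), \tr (c *m Z)%R == 0%R].
Let S := [seq k%:R - t%:R | k <- iota 0 t.*2.+1] : seq 'F_p.

(** If \tr c is nonzero the sum is empty, because the identity commutes with every X. *)
Lemma sum_box_le (c : 'M['F_p]_n) :
  (\sum_(X : 'M['I_t.*2.+1]_n | orth c (box_mx p X)) cent_card (box_mx p X) <=
   (\tr c == 0%R) * (sum_const m A * (H ^ n * t.*2.+1 ^ (n * n + n - (c != 0%R) * m))))%N.
Proof.
have t0 : (0 < t)%N by apply: leq_trans t_large.
have nnHt : (n * n <= n * n * (H * t))%N by rewrite leq_pmulr // muln_gt0 H0.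
have tp : (t.*2 < p)%N.
  apply: leq_ltn_trans p_large; rewrite -muln2 mulnC leq_mul // mulnA leq_pmull // !muln_gt0.
  by rewrite H0.
have np : (n < p)%N.
  apply: leq_ltn_trans p_large; apply: (@leq_trans (n * n)); first by rewrite leq_pmulr.
  by apply: leq_trans nnHt _; rewrite leq_pmull.
have sS : size S = t.*2.+1 by rewrite size_map size_iota.
have uS : uniq S.
  rewrite map_inj_in_uniq ?iota_uniq // => k l; rewrite !mem_iota !add0n !ltnS => kt lt.
  move=> /addIr /(congr1 val); rewrite /= !val_Fp_nat // !modn_small //; exact: leq_ltn_trans tp.
have [trc|trc] := eqVneq (\tr c) 0; last first.
  rewrite mul0n leqn0 big_pred0 // => X; apply/negP => /forall_inP/(_ 1%:M).
  by rewrite inE mulmx1 mul1mx eqxx => /(_ isT); rewrite mulmx1 (negPf trc).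
rewrite mul1n.
have SL : (2 * (n * n) <= size S)%N by rewrite sS -addnn mul2n -addnn -addSn leq_add // ltnW.
have pS : (p <= A * (H * size S))%N.
  by apply: leq_trans p_le _; rewrite !leq_mul2l sS -addnn -addSn leq_addl !orbT.
have HS : (H ^ n.+1 <= size S)%N by rewrite sS (leq_trans H_le) // -addnn -addSn leq_addl.
have := sum_cent_card_Fp p_prime np uS A0 H0 SL pS HS trc.
rewrite [in X in (_ <= X)%N -> _]sS; apply: leq_trans.
pose XX := [set X : 'M['I_t.*2.+1]_n | orth c (box_mx p X)].
rewrite (eq_bigl (fun X => X \in XX)) => [|X]; last by rewrite inE.
rewrite -(big_imset (@cent_card _ m)) /=; last first.
  by move=> ? ? _ _; apply: box_mx_inj.
rewrite big_mkcond [X in (_ <= X)%N]big_mkcond; apply: leq_sum => X _.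
case: ifP => // /imsetP[Y]; rewrite inE => Yo ->; rewrite Yo andbT.
suff -> : [forall i, forall j, box_mx p Y i j \in S] by [].
apply/forallP => i; apply/forallP => j; rewrite mxE; apply/mapP.
by exists (Y i j : nat) => //; rewrite mem_iota ltn_ord.
Qed.

(** Reduction modulo p can only create commuting pairs. After [card_box_le] the sums over X and c
    are exchanged: c = 0 is a single term, and each nonzero c saves a factor of (2t + 1)^m. *)
Lemma pair_count_le :
  (pair_count n t * H ^ (n * n) <=
    4 * ((1 + 2 ^ (n * n)) * (sum_const m A * (H ^ n * t.*2.+1 ^ (n * n + n)))))%N.
Proof.
have tp : (t.*2 < p)%N.
  apply: leq_ltn_trans p_large; rewrite -muln2 mulnC leq_mul // mulnA leq_pmull // !muln_gt0.
  by rewrite H0.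
have pair_le : (pair_count n t <=
    \sum_(X : 'M['I_t.*2.+1]_n) #|[set Y : 'M['I_t.*2.+1]_n | box_mx p Y \in L (box_mx p X)]|)%N.
  pose Z (X : 'M['I_t.*2.+1]_n) := [set Y : 'M['I_t.*2.+1]_n |
     int_box_mx X *m int_box_mx Y == int_box_mx Y *m int_box_mx X].
  rewrite /pair_count -sum1_card (eq_bigl (fun XY => xpredT XY.1 && (XY.2 \in Z XY.1))); last first.
    by move=> XY; rewrite !inE.
  rewrite -(pair_big_dep xpredT (fun X Y => Y \in Z X) (fun _ _ => 1%N)) /=.
  apply: leq_sum => X _; rewrite sum1_card; apply: subset_leq_card; apply/subsetP => Y.
  by rewrite !inE -!reduce_box -!map_mxM => /eqP ->.
apply: (@leq_trans (\sum_(X : 'M['I_t.*2.+1]_n)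
    4 * (cent_card (box_mx p X) * #|[set c : 'M['I_H.*2]_n | orth (diff_mx p c) (box_mx p X)]|))).
  apply: leq_trans (leq_mul pair_le (leqnn _)) _; rewrite big_distrl /=; apply: leq_sum => X _.
  apply: (card_box_le ec0 es0 ecB esB ec_lt1 ec_small) => //; try exact: ltnW.
    by rewrite inE mulmx0 mul0mx.
  by move=> Y Z; rewrite !inE mulmxBl mulmxBr => /eqP -> /eqP ->.
rewrite -big_distrr leq_mul2l /=.
have -> : (\sum_(X : 'M['I_t.*2.+1]_n) cent_card (box_mx p X) *
      #|[set c : 'M['I_H.*2]_n | orth (diff_mx p c) (box_mx p X)]| =
   \sum_(c : 'M['I_H.*2]_n) \sum_(X : 'M['I_t.*2.+1]_n | orth (diff_mx p c) (box_mx p X))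
      cent_card (box_mx p X))%N.
  rewrite (exchange_big_dep xpredT) //=; apply: eq_bigr => X _.
  by rewrite sum_nat_const mulnC; congr (_ * _)%N; apply: eq_card => c; rewrite inE.
apply: (@leq_trans (\sum_(c : 'M['I_H.*2]_n) ((\tr (diff_mx p c) == 0%R) *
    (sum_const m A * (H ^ n * t.*2.+1 ^ (n * n + n - (diff_mx p c != 0%R) * m)))))).
  by apply: leq_sum => c _; exact: sum_box_le.
rewrite (bigID (fun c => diff_mx p c == 0)) /= mulnDl mul1n leq_add //.
  rewrite (eq_bigr (fun=> (sum_const m A * (H ^ n * t.*2.+1 ^ (n * n + n)))%N)); last first.
    by move=> c /eqP ->; rewrite mxtrace0 eqxx mul1n mul0n subn0.
  rewrite sum_nat_const -[X in (_ <= X)%N]mul1n leq_mul2r; apply/orP; right.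
  apply/card_le1P => c cA c'; have c0 : diff_mx p c = 0 by apply/eqP.
  apply/idP/eqP => [c'A|->]; last exact: cA.
  have c'0 : diff_mx p c' = 0 by apply/eqP.
  by apply: diff_mx_inj; rewrite c0.
apply: (@leq_trans (\sum_(c in [set c : 'M['I_H.*2]_n | \tr (diff_mx p c) == 0%R])
    sum_const m A * (H ^ n * t.*2.+1 ^ (n * n + n - m)))).
  rewrite big_mkcond [X in (_ <= X)%N]big_mkcond; apply: leq_sum => c _.
  rewrite inE; case: eqVneq => //= _; case: eqP => _; rewrite ?mul0n //.
  by rewrite !mul1n.
rewrite sum_nat_const.
apply: leq_trans (leq_mul card_trace0 (leqnn _)) _.
(* Since n^2 - 1 = (n + 1)(n - 1), the bound on H^(n+1) gives H^(n^2-1) <= t^m, so the number of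
   nonzero c is matched by the saving for each. *)
have nn1 : ((n * n).-1 = n.+1 * m)%N by rewrite mulnS mulSn; clear; lia.
have mn : (m <= n * n + n)%N by rewrite (leq_trans (leqnSn m)) // leq_addl.
have Hm : (H.*2 ^ (n * n).-1 <= 2 ^ (n * n) * t.*2.+1 ^ m)%N.
  rewrite -muln2 expnMn mulnC leq_mul //; first by rewrite leq_pexp2l // leq_pred.
  rewrite nn1 expnM leq_expW // (leq_trans H_le) // -addnn -addSn leq_addl.
  by [].
apply: leq_trans (leq_mul Hm (leqnn _)) _.
have -> : (t.*2.+1 ^ (n * n + n) = t.*2.+1 ^ (n * n + n - m) * t.*2.+1 ^ m)%N.
  by rewrite -expnD subnK.
rewrite leq_eqVlt; apply/orP; left; apply/eqP.
move: (2 ^ _)%N (t.*2.+1 ^ m)%N (sum_const m A) (H ^ n)%N (t.*2.+1 ^ _)%N; clear => *; ring.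
Qed.

End Count.

Unset Implicit Arguments.

From mathcomp Require Import all_classical all_reals all_analysis.
Import Order.TTheory GRing.Theory Num.Theory.
Import numFieldNormedType.Exports.
Local Open Scope ring_scope.

(** * The additive character modulo p by sines and cosines *)

Section Trig.
Variables (R : realType) (p : nat).
Hypothesis p_prime : prime p.

Definition angle (x : 'F_p) : R := pi *+ 2 * (x : nat)%:R / p%:R.
Definition Fcos x := cos (angle x).
Definition Fsin x := sin (angle x).

Let p_gt0 : 0 < p%:R :> R. Proof. by rewrite ltr0n prime_gt0. Qed.

Lemma angle_nat k : exists q : nat,
  pi *+ 2 * k%:R / p%:R = angle k%:R + pi *+ 2 *+ q :> R.
Proof.
exists (k %/ p)%N; rewrite /angle val_Fp_nat // {1}(divn_eq k p) natrD natrM.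
by rewrite -[_ *+ (k %/ p)]mulr_natr; field; exact: lt0r_neq0.
Qed.

Lemma Fcos_nat k : Fcos k%:R = cos (pi *+ 2 * k%:R / p%:R).
Proof. by have [q ->] := angle_nat k; rewrite (periodicn (@cosD2pi R)). Qed.

Lemma Fsin_nat k : Fsin k%:R = sin (pi *+ 2 * k%:R / p%:R).
Proof. by have [q ->] := angle_nat k; rewrite (periodicn (@sinD2pi R)). Qed.

(** A natural number representing the difference, so that only a full turn has to be removed from
    the angle. *)
Lemma Fp_subE (x y : 'F_p) : x - y = (x + (p - y))%:R.
Proof.
have yp : (y <= p)%N by rewrite ltnW // -[X in (_ < X)%N](Fp_cast p_prime).
by rewrite natrD natrB // !natr_Zp pchar_Fp_0 // sub0r.
Qed.

Lemma angle_sub (x y : 'F_p) :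
  pi *+ 2 * (x + (p - y))%:R / p%:R = angle x - angle y + pi *+ 2 :> R.
Proof.
have yp : (y <= p)%N by rewrite ltnW // -[X in (_ < X)%N](Fp_cast p_prime).
by rewrite /angle natrD natrB //; field; exact: lt0r_neq0.
Qed.

Lemma FcosB x y : Fcos (x - y) = Fcos x * Fcos y + Fsin x * Fsin y.
Proof. by rewrite {1}Fp_subE Fcos_nat angle_sub cosD2pi cosB. Qed.

Lemma FsinB x y : Fsin (x - y) = Fsin x * Fcos y - Fcos x * Fsin y.
Proof. by rewrite {1}Fp_subE Fsin_nat angle_sub sinD2pi sinB. Qed.

Lemma Fcos0 : Fcos 0 = 1. Proof. by rewrite /Fcos /angle mulr0 mul0r cos0. Qed.

Lemma Fsin0 : Fsin 0 = 0. Proof. by rewrite /Fsin /angle mulr0 mul0r sin0. Qed.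

(** Half the angle lies strictly between 0 and pi, where the sine is positive, and cos 2h = 1 - 2
    sin^2 h. *)
Lemma Fcos_lt1 x : x != 0 -> Fcos x < 1.
Proof.
move=> x0; pose h : R := pi * (x : nat)%:R / p%:R.
have -> : Fcos x = cos (h *+ 2) by rewrite /Fcos /angle /h !mulrnAl.
have xp : ((x : nat)%:R : R) < p%:R.
  by rewrite ltr_nat -[X in (_ < X)%N](Fp_cast p_prime).
have x_gt0 : 0 < (x : nat)%:R :> R.
  by rewrite ltr0n lt0n; apply: contra x0 => /eqP x0; apply/eqP/val_inj.
have : 0 < sin h.
  apply: sin_gt0_pi; rewrite /h divr_gt0 ?mulr_gt0 ?pi_gt0 //=.
  by rewrite ltr_pdivrMr // ltr_pM2l ?pi_gt0.
by rewrite cos_mulr2n cos2sin2 => sh; nra.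
Qed.

(** The angle h is at most pi / 4, so cos 2h >= 0 and hence cos^2 h >= 1 / 2. *)
Lemma Fcos_small k : (8 * k <= p)%N -> 2^-1 <= Fcos k%:R.
Proof.
move=> kp; rewrite Fcos_nat; set h := _ / _.
have h0 : 0 <= h.
  apply: divr_ge0; last exact: ltW.
  by apply: mulr_ge0 => //; rewrite mulrn_wge0 // pi_ge0.
have h4 : h *+ 2 <= pi / 2.
  have : (8 * k)%:R <= p%:R :> R by rewrite ler_nat.
  rewrite natrM => kpR; rewrite /h -mulrnAl ler_pdivrMr //.
  have := @pi_gt0 R; move: kpR; set x := k%:R; set y := p%:R; set c := pi.
  by move=> ? ?; nra.
have c1 : 0 <= cos h by apply: cos_ge0_pihalf; apply/andP; split; lra.
have : 0 <= cos (h *+ 2) by apply: cos_ge0_pihalf; apply/andP; split; lra.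
by rewrite cos_mulr2n; nra.
Qed.

End Trig.

(** * Choice of the prime and passage to real T *)

Section Bound.
Variable R : realType.
Local Open Scope nat_scope.

Lemma pair_count_small n t : pair_count n t <= t.*2.+1 ^ (2 * (n * n)).
Proof.
apply: leq_trans (max_card _) _.
by rewrite card_prod !card_mx card_ord -expnD addnn mul2n.
Qed.

Lemma pair_count_bound m : exists C, forall t H, 0 < t -> 0 < H -> H ^ m.+2 <= t ->
  pair_count m.+1 t * H ^ (m.+1 * m) <= C * t.*2.+1 ^ (m.+1 * m.+1 + m.+1).
Proof.
set n := m.+1; have [c c0 cP] := weak_bertrand.
pose A := c * (8 * (n * n)).
(* The first summand comes from [pair_count_le]; the second bounds everything trivially when t <
   n^2, where also H <= t. *)
exists (4 * ((1 + 2 ^ (n * n)) * sum_const m A) + (n * n).*2.+1 ^ (2 * (n * n)) * (n * n) ^ (n * m)).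
move=> t H t0 H0 Ht; have [tn|nt] := ltnP t (n * n).
  rewrite -[X in X <= _]muln1 leq_mul ?expn_gt0 //.
  apply: leq_trans (leq_addl _ _); apply: leq_mul.
    apply: leq_trans (pair_count_small _ _) _; apply: leq_expW.
    by rewrite ltnS leq_double ltnW.
  apply: leq_expW; apply: leq_trans (ltnW tn); apply: leq_trans Ht.
  by rewrite -{1}[H]expn1 leq_pexp2l.
(* The prime must exceed 8 n^2 H t for the cosine bound and be at most a constant times H t. *)
have N0 : 0 < 8 * (n * n * (H * t)) by rewrite !muln_gt0 H0 t0.
have [p pp /andP[Np pN]] := cP _ N0.
have A0 : 0 < A by rewrite !muln_gt0 c0.
have pA : p <= A * (H * t) by rewrite /A -!mulnA in pN *.
have := @pair_count_le R p (@Fcos R p) (@Fsin R p) (Fcos0 _ _) (Fsin0 _ _) (@FcosB _ _ pp)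
  (@FsinB _ _ pp) (@Fcos_lt1 _ _ pp) (@Fcos_small _ _ pp) m t A H pp H0 A0 nt Np pA Ht.
rewrite -/n; set e := n * n + n => h.
have Hn : 0 < H ^ n by rewrite expn_gt0 H0.
rewrite mulnDl; apply: leq_trans (leq_addr _ _).
rewrite -(leq_pmul2r Hn) -mulnA -expnD (_ : n * m + n = n * n); last by rewrite [RHS]mulnS addnC.
apply: leq_trans h _; rewrite leq_eqVlt; apply/orP; left; apply/eqP.
by move: (2 ^ _) (sum_const m A) (H ^ n) (t.*2.+1 ^ _); clear => *; ring.
Qed.

Lemma Ncomm_le n (T : R) : (0 <= T)%R -> Ncomm n T <= pair_count n (Num.truncn T).
Proof.
move=> T0; set t := Num.truncn T; rewrite /Ncomm /pair_count.
set PS := [set XY | _]%SET.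
have entry (X : 'M[int]_n) i j : (`|X|%:~R <= T)%R -> `|X i j|%N <= t.
  move=> XT; rewrite /t Num.Theory.truncn_ge_nat //.
  apply: le_trans XT; rewrite natr_absz ler_int int_mx_normE.
  by apply/bigmax_geP; right => /=; exists (i, j).
pose enc (X : 'M[int]_n) : 'M['I_t.*2.+1]_n := \matrix_(i, j) inord `|(X i j + t%:Z)%R|%N.
have encK (X : 'M[int]_n) : (`|X|%:~R <= T)%R -> int_box_mx (enc X) = X.
  move=> XT; apply/matrixP => i j; rewrite !mxE.
  have := entry X i j XT; move: (X i j) => x xt.
  rewrite inordK; lia.
apply: leq_trans (_ : #|` [fset (int_box_mx XY.1, int_box_mx XY.2) | XY in PS]%fset| <= _).
  apply: fsubset_leq_card; apply/fsubsetP => -[X Y].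
  rewrite in_fset_set; last exact: finite_commuting_pairs.
  move=> /set_mem[/= XT YT XY]; apply/imfsetP; exists (enc X, enc Y) => /=.
    by rewrite inE /= !encK // XY.
  by rewrite !encK.
by rewrite (leq_trans (leq_imfset_card _ _ _)) //= cardE.
Qed.

End Bound.

Theorem theorem1p1 (R : realType) (n : nat) (hn : (2 <= n)%N) :
  exists C : R, 0 < C /\
    forall T : R, 1 <= T ->
      (@Ncomm R n T)%:R <= C * T `^ (n%:R ^+ 2 + 2 - 2 / (n%:R + 1)).
Proof.
case: n hn => // m m1; set n := m.+1.
have [C0 C0P] := pair_count_bound R m.
(* The 3 comes from 2t + 1 <= 3T, the 2 from T^(1/(n+1)) <= 2H; adding 1 makes the constant
   positive. *)
exists (C0%:R * 3 ^+ (n * n + n) * 2 ^+ (n * m) + 1).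
split; first by rewrite ltr_wpDl.
move=> T T1; have T0 : 0 < T by apply: lt_le_trans T1.
set t := Num.truncn T.
have t0 : (0 < t)%N by rewrite Num.Theory.truncn_gt0.
have tT : t%:R <= T by rewrite Num.Theory.truncn_le ltW.
have Tt : T < t.+1%:R by rewrite Num.Theory.truncnS_gt.
have exH : exists H, (H ^ n.+1 <= t)%N by exists 0%N; rewrite exp0n.
have Hmax H : (H ^ n.+1 <= t)%N -> (H <= t)%N.
  by move=> h; apply: leq_trans h; case: H => // H; rewrite -{1}[H.+1]expn1 leq_pexp2l.
case: (ex_maxnP exH Hmax) => H Ht Hm.
have H0 : (0 < H)%N by apply: Hm; rewrite exp1n.
have tH : (t < H.+1 ^ n.+1)%N by rewrite ltnNge; apply/negP => /Hm; rewrite ltnn.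
(* a is the real counterpart of H: maximality gives T < t + 1 <= (H + 1)^(n+1) <= (2H)^(n+1). *)
pose a : R := T `^ (n.+1%:R)^-1.
have a0 : 0 < a by rewrite powR_gt0.
have aT : a ^+ n.+1 = T.
  by rewrite -powR_mulrn ?powR_ge0 // -powRrM mulVf ?pnatr_eq0 // powRr1 // ltW.
have aH : a <= 2 * H%:R.
  rewrite -(@ler_pXn2r _ n.+1) ?nnegrE ?mulr_ge0 ?(ltW a0) // aT.
  apply: le_trans (ltW Tt) _; rewrite -natrM -natrX ler_nat (leq_trans tH) //.
  by apply: leq_expW; rewrite mul2n -addnn -addn1 leq_add2l.
(* The exponents add up because n(n - 1)/(n + 1) = n - 2 + 2/(n + 1). *)
have expE : T `^ (n%:R ^+ 2 + 2 - 2 / (n%:R + 1)) * a ^+ (n * m) = T ^+ (n * n + n).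
  rewrite -powR_mulrn ?powR_ge0 // -powRrM -powRD; last first.
    by apply/implyP => _; rewrite gt_eqF.
  rewrite -powR_mulrn ?(ltW T0) //; congr (_ `^ _).
  have n10 : n%:R + 1 != 0 :> R by rewrite natr1 pnatr_eq0.
  rewrite natrD !natrM -natr1 (_ : m%:R = n%:R - 1); last by rewrite /n -natr1 addrK.
  by field.
have Pa : 0 < a ^+ (n * m) by rewrite exprn_gt0.
rewrite -(ler_pM2r Pa) -[_ * _ `^ _ * _]mulrA expE.
apply: le_trans (_ : (pair_count n t)%:R * a ^+ (n * m) <= _).
  by rewrite ler_pM2r // ler_nat Ncomm_le // ltW.
apply: le_trans (_ : (pair_count n t)%:R * (2 * H%:R) ^+ (n * m) <= _).
  by apply: ler_wpM2l => //; apply: lerXn2r; rewrite ?nnegrE ?mulr_ge0 // ltW.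
have h : (pair_count n t)%:R * H%:R ^+ (n * m) <= C0%:R * (t.*2.+1)%:R ^+ (n * n + n) :> R.
  by rewrite -!natrX -!natrM ler_nat; exact: C0P.
have h3 : ((t.*2.+1)%:R : R) ^+ (n * n + n) <= 3 ^+ (n * n + n) * T ^+ (n * n + n).
  rewrite -exprMn; apply: lerXn2r; rewrite ?nnegrE ?mulr_ge0 ?(ltW T0) //.
  by rewrite -natr1 -mul2n natrM; move: tT T1; set x := t%:R; lra.
rewrite exprMn mulrCA [X in _ <= X]mulrDl mul1r.
apply: le_trans (_ : _ <= C0%:R * 3 ^+ (n * n + n) * 2 ^+ (n * m) * T ^+ (n * n + n)) _; last first.
  by rewrite lerDl exprn_ge0 // ltW.
rewrite [X in _ <= X](_ : _ = 2 ^+ (n * m) * (C0%:R * (3 ^+ (n * n + n) * T ^+ (n * n + n)))); last by ring.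
apply: ler_wpM2l; first by rewrite exprn_ge0.
by apply: le_trans h _; apply: ler_wpM2l.
Qed.
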